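(* For every integer $m\geq 16$, the binary cyclic code $C=C_m$ of length $2^m-1$ generated by $m_1(x)m_{-1}(x)m_3(x)$ has minimum distance $5$.
   Context: Let $q=2^m$ and let $\alpha$ be a generator of the multiplicative group $\mathbb{F}_q^*$. For an integer $i$, $m_i(x)$ denotes the minimal polynomial of $\alpha^i$ over $\mathbb{F}_2$. A binary cyclic code of length $n$ is an ideal of $\mathbb{F}_2[x]/(x^n-1)$; a codeword $c_0+c_1x+\cdots+c_{n-1}x^{n-1}$ is identified with the vector $(c_0,\ldots,c_{n-1})\in\mathbb{F}_2^n$, and weights and distances are Hamming weights and distances. $C_m$ is the ideal of $\mathbb{F}_2[x]/(x^{2^m-1}-1)$ generated by $m_1(x)m_{-1}(x)m_3(x)$; equivalently it is the intersection of the cyclic code generated by $m_1(x)m_3(x)$ and the cyclic code generated by $m_1(x)m_{-1}(x)$, i.e. the set of $c(x)$ with $c(\alpha)=c(\alpha^{3})=c(\alpha^{-1})=0$. *)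

(* Defs.v *)
From HB Require Import structures.
From mathcomp Require Import all_boot all_order all_algebra all_field.

Set Implicit Arguments.
Unset Strict Implicit.
Unset Printing Implicit Defensive.

Import GRing.Theory.
Local Open Scope ring_scope.

(* The library's [minPoly 1 x] has its coefficients in the image of K but
   lives in {poly L}; [base_minPoly x] is the same polynomial in {poly K}. *)
Definition base_minPoly (K : fieldType) (L : fieldExtType K) (x : L) :
    {poly K} :=
  sval (sig_eqW (polyOver1P (minPolyOver 1%AS x))).

Lemma base_minPolyE (K : fieldType) (L : fieldExtType K) (x : L) :
  map_poly (in_alg L) (base_minPoly x) = minPoly 1%AS x.
Proof. by rewrite /base_minPoly; case: sig_eqW. Qed.

Definition mul_generator (L : fieldType) (alpha : L) : Prop :=
  alpha != 0 /\ forall x : L, x != 0 -> exists i : int, x = alpha ^ i.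

Definition principal_ideal (R : finComNzRingType) (g : R) : {set R} :=
  [set a * g | a : R].

(* {poly %/ 'X^n - 1} is F_2[x]/(x^n - 1) only for n > 0: the library replaces
   the modulus 0 obtained for n = 0 by 'X. *)
Definition cyclic_code (n : nat) (g : {poly 'F_2}) : {set 'rV['F_2]_n} :=
  [set \row_(i < n) (c : {poly 'F_2})`_i
     | c : {poly %/ 'X^n - 1} in principal_ideal (in_qpoly ('X^n - 1) g)].

Definition hamming_distance (F : eqType) (n : nat) (u v : 'rV[F]_n) : nat :=
  #|[set i | u 0 i != v 0 i]|.

Definition has_minimum_distance (F : finType) (n : nat)
    (C : {set 'rV[F]_n}) (d : nat) : Prop :=
  (exists u v, [/\ u \in C, v \in C, u != v & hamming_distance u v = d]) /\
  (forall u v, u \in C -> v \in C -> u != v -> (d <= hamming_distance u v)%N).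

(* Main.v *)
From Stdlib Require Import Ring Field BinNat Pnat.
Require Import Defs.
From HB Require Import structures.
From mathcomp Require Import all_boot all_order all_algebra all_field.

Set Implicit Arguments.
Unset Strict Implicit.
Unset Printing Implicit Defensive.

Import Order.TTheory GRing.Theory Num.Theory.
Local Open Scope ring_scope.

(** A word of weight w in the code is a set of w distinct nonzero elements of
F_q, q = 2^m, whose sum, sum of cubes and sum of inverses vanish.  The first
two conditions already force w >= 5, because (x+y)(x+z)(y+z) =
x^3+y^3+z^3 + (x+y+z)^3.  For w = 5 the three conditions say that the elements
are the roots of a polynomial X^5 + a X^3 + b with b <> 0.  If m = 16 the fifth
roots of unity will do (a = 0); if m >= 17 we count the b for which
X^5 + X^3 + b splits.

The geometric Galois group of X^5 + X^3 + b over F_2(b) is S_5, so 120 times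
the number of such b is the sum over b of the regular character of S_5 at
Frobenius.  That character can be written in terms of the number r of roots, the
number p of quadratic factors, and the sign of Frobenius, which by Berlekamp is
chi(1 + 1/b), chi being the quadratic (Artin-Schreier) character of F_q.  The
quadratic factors are parametrized by v in F_q, with b =
v(v+1)^6/(v^2+v+1)^5 and sign chi(v^3+v+1/v).  Hence the count is
q + 5 S - E + O(1) with E = sum chi(x^3+x) up to sign, of order sqrt q, and
S = sum chi(x^3+x+1/x).

Weil's bound for S is not needed.  S is unchanged when x^3+x+1/x is replaced by
k^3 x^3 + k x + 1/(k x), so the third moment over triples of distinct points
takes the same value T = S^3 - (3q-5) S at q-1 parameters; since a triple
is determined by its sums of cubes, elements and inverses, Parseval gives
T^2 <= 6 q^5, which forces S > -0.195 q as soon as q >= 2^17. *)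

(** * Identities in characteristic 2 *)

(* Stdlib's [ring] and [field], with coefficients in F_2 (represented by [bool])
   so that 2 = 0 is built in.  They match operators syntactically; since the
   structure instances in a goal vary, its operators are first folded into the
   constants below. *)
Section Char2Normalization.
Variable F : fieldType.

Definition fadd (x y : F) : F := x + y.
Definition fmul (x y : F) : F := x * y.
Definition fopp (x : F) : F := - x.
Definition finv (x : F) : F := x^-1.
Definition fexp (x : F) (n : nat) : F := x ^+ n.
Definition fzero : F := 0.
Definition fone : F := 1.
Definition foldE :=
  ((fun x y => erefl : x + y = fadd x y, fun x y => erefl : x * y = fmul x y),
   (fun x => erefl : - x = fopp x, fun x => erefl : x^-1 = finv x),
   fun x n => erefl : x ^+ n = fexp x n, (erefl : 0 = fzero, erefl : 1 = fone)).
(** Recasts the type of an equation as the carrier of a field structure, the form in which the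
    tactics look it up. *)
Lemma as_field_eq (x y : F) : x = y -> x = y. Proof. by []. Qed.

Lemma field_theory_of : field_theory fzero fone fadd fmul
  (fun x y => fadd x (fopp y)) fopp (fun x y => fmul x (finv y)) finv eq.
Proof.
split.
- by split; [exact: add0r | exact: addrC | exact: addrA | exact: mul1r
    | exact: mulrC | exact: mulrA | exact: mulrDl | | exact: subrr].
- by apply/eqP; exact: oner_neq0.
- by [].
- by move=> p /eqP; exact: mulVf.
Qed.

Lemma power_theory_of : power_theory fone fmul eq N.to_nat fexp.
Proof.
split=> r n; case: n => //= p.
elim/BinPos.Pos.peano_ind: p => [|p IH]; first by rewrite /fexp expr1.
rewrite Pnat.Pos2Nat.inj_succ {1}/fexp exprS; rewrite /fexp in IH; rewrite IH.
symmetry; apply: (Ring_theory.pow_pos_succ (Eqsth F)); exact: mulrA.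
Qed.

Lemma bool_morph : 2 \in [pchar F] ->
  ring_morph fzero fone fadd fmul (fun x y => fadd x (fopp y)) fopp eq
  false true xorb andb xorb id Bool.eqb (fun b : bool => b%:R).
Proof.
move=> F2; have o11 : 1 + 1 = 0 :> F by rewrite -(pcharf0 F2) mulr2n.
rewrite /fadd /fmul /fopp /fzero /fone; split=> //.
- by do 2!case; rewrite /= ?addr0 ?add0r ?o11.
- by do 2!case; rewrite /= ?subr0 ?sub0r ?subrr ?oppr_pchar2.
- by do 2!case; rewrite /= ?mulr0 ?mul0r ?mulr1.
- by case; rewrite /= ?oppr0 ?oppr_pchar2.
- by do 2!case.
Qed.
End Char2Normalization.

Ltac bool_cst t := match t with
  | fzero _ => constr:(false) | fone _ => constr:(true)
  | _ => constr:(InitialRing.NotConstant) end.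
Ltac nat_cst t := match isnatcst t with
  | true => constr:(N.of_nat t) | _ => constr:(InitialRing.NotConstant) end.
Ltac char2_fold := intros; rewrite ?foldE; refine (@as_field_eq _ _ _ _).
Ltac char2_ring := char2_fold; ring.
Ltac char2_field := char2_fold; field.

From mathcomp Require Import ring lra zify.

Section Char2.
Variable F : fieldType.
Hypothesis F2 : 2 \in [pchar F].
Add Field F_field : (field_theory_of F) (morphism (bool_morph F2),
  constants [bool_cst], power_tac (power_theory_of F) [nat_cst]).

Lemma char2_addr_eq0 (x y : F) : x + y = 0 -> x = y.
Proof. by move=> h; rewrite -[y]add0r -h -addrA addrr_pchar2 ?addr0. Qed.

(* The factorization of [quintic (quad_const v)] into [quad_factor v] and
   [cubic_factor v] is [quad_factorM]; conversely the factor X^2 + s X + p comes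
   from v = s(1+s)/p.  All of these are meaningful only under [quad_param]. *)
Definition quad_norm (v : F) : F := v ^+ 2 + v + 1.
Definition quad_sum (v : F) : F := v / quad_norm v.
Definition quad_prod (v : F) : F := (v + 1) ^+ 2 / quad_norm v ^+ 2.
Definition quad_const (v : F) : F := v * (v + 1) ^+ 6 / quad_norm v ^+ 5.
Definition artin_schreier (a : F) := exists z : F, z ^+ 2 + z = a.

Lemma artin_schreierD a b :
  artin_schreier a -> artin_schreier b -> artin_schreier (a + b).
Proof. by move=> [x <-] [y <-]; exists (x + y); char2_ring. Qed.

Lemma artin_schreier_sqrD a : artin_schreier (a ^+ 2 + a).
Proof. by exists a. Qed.

Lemma artin_schreier_sqrt a : artin_schreier (a ^+ 2) -> artin_schreier a.
Proof.
move=> /artin_schreierD/(_ (artin_schreier_sqrD a)).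
by rewrite addrA addrr_pchar2 // add0r.
Qed.

(* The y_i are the roots of [cubic_factor v] multiplied by [quad_norm v]; the
   witness is Berlekamp's sum of y_i / (y_i + y_j) over i < j, up to an obvious
   correction, and D is the square root of the discriminant. *)
Lemma cubic_parity (y1 y2 y3 v : F) : v != 0 -> v + 1 != 0 ->
  y1 + y2 + y3 = v -> y1 * y2 + y1 * y3 + y2 * y3 = v ^+ 2 * (v + 1) ^+ 2 ->
  y1 * y2 * y3 = v * (v + 1) ^+ 4 -> artin_schreier (v ^+ 3 + v + 1).
Proof.
move=> v0 v1 e1 e2 e3.
have D : (y1 + y2) * (y1 + y3) * (y2 + y3) = v * (v + 1) ^+ 2.
  transitivity ((y1 + y2 + y3) * (y1 * y2 + y1 * y3 + y2 * y3) + y1 * y2 * y3);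
    first by char2_ring.
  by rewrite e1 e2 e3; char2_ring.
have : (y1 + y2) * (y1 + y3) * (y2 + y3) != 0 by rewrite D mulf_neq0 ?expf_neq0.
rewrite !mulf_eq0 !negb_or => /andP[/andP[/eqP d12 /eqP d13] /eqP d23].
apply: artin_schreier_sqrt.
(* Adding v^4 + v^2, which has the form z^2 + z, gives the square of v^3 + v + 1. *)
suff : artin_schreier (v ^+ 6 + v ^+ 4 + 1).
  move=> /artin_schreierD/(_ (artin_schreier_sqrD (v ^+ 2))).
  by congr artin_schreier; char2_ring.
exists (y1 / (y1 + y2) + y1 / (y1 + y3) + y2 / (y2 + y3)).
(* For z = y_i / (y_i + y_j) one has z^2 + z = y_i y_j / (y_i + y_j)^2, so the total is symmetric in
   the y_i, with denominator D^2. *)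
transitivity (((y1 + y2 + y3) ^+ 3 * (y1 * y2 * y3) + (y1 * y2 + y1 * y3 +
  y2 * y3) ^+ 3
  + (y1 + y2 + y3) * (y1 * y2 + y1 * y3 + y2 * y3) * (y1 * y2 * y3)
    + (y1 * y2 * y3) ^+ 2) / 
  ((y1 + y2) * (y1 + y3) * (y2 + y3)) ^+ 2).
  by char2_field.
by rewrite D e1 e2 e3; move/eqP: v0 => v0; move/eqP: v1 => v1; char2_field.
Qed.

(* The sign of the quintic is the product of the signs of its cubic and
   quadratic factors. *)
Lemma const_parity v : v != 0 -> v + 1 != 0 -> quad_norm v != 0 ->
  artin_schreier (1 + (quad_const v)^-1 + (v ^+ 3 + v + 1) + (1 + v^-1)).
Proof.
move=> /eqP v0 /eqP v1 /eqP n0.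
(* Partial fractions: the pole at v = 0 and the cubic terms cancel, and the witness is read off from
   what remains in powers of v + 1. *)
exists (v + 1 + 1 / (v + 1) + 1 / (v + 1) ^+ 2 + 1 / (v + 1) ^+ 3).
by rewrite /quad_const /quad_norm in n0 *; char2_field.
Qed.
End Char2.

(** * Factors of the quintic *)

Section Quintic.
Variable F : fieldType.
Hypothesis F2 : 2 \in [pchar F].
Add Field F_field : (field_theory_of F) (morphism (bool_morph F2),
  constants [bool_cst], power_tac (power_theory_of F) [nat_cst]).
Let addff (x : F) : x + x = 0. Proof. exact: addrr_pchar2. Qed.
Let addff_eq (x y : F) : x + y = 0 -> x = y. Proof. exact: char2_addr_eq0. Qed.

Definition quintic (b : F) : {poly F} := 'X^5 + 'X^3 + b%:P.
Definition monic_quadratic (s p : F) : {poly F} := 'X^2 + s%:P * 'X + p%:P.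
Definition monic_cubic (c2 c1 c0 : F) : {poly F} :=
  'X^3 + c2%:P * 'X^2 + c1%:P * 'X + c0%:P.
Definition quad_factor v := monic_quadratic (quad_sum v) (quad_prod v).
Definition cubic_factor v := monic_cubic (quad_sum v)
  (1 + quad_sum v ^+ 2 + quad_prod v) (quad_sum v * (1 + quad_sum v) ^+ 2).
Definition quad_param (v : F) : bool := [&& v != 0, v + 1 != 0 & quad_norm v != 0].

Lemma monic_coefP (f : {poly F}) n :
  f`_n = 1 -> (forall i, (n < i)%N -> f`_i = 0) -> f \is monic /\ size f = n.+1.
Proof.
move=> fn fi; suff sf : size f = n.+1 by rewrite monicE lead_coefE sf /= fn.
apply/eqP; rewrite eqn_leq ltnNge; apply/andP; split; first exact/leq_sizeP.
by apply/negP => /leq_sizeP/(_ n (leqnn n))/eqP; rewrite fn oner_eq0.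
Qed.

Lemma quintic_spec b : quintic b \is monic /\ size (quintic b) = 6%N.
Proof.
by apply: monic_coefP => [|[|[|[|[|[|[|i]]]]]]] //; rewrite !coefE /= !addr0.
Qed.

Lemma quadratic_spec s p :
  monic_quadratic s p \is monic /\ size (monic_quadratic s p) = 3%N.
Proof.
by apply: monic_coefP => [|[|[|[|i]]]] //; rewrite !coefE /= !(mulr0, addr0).
Qed.

Lemma cubic_spec a b c :
  monic_cubic a b c \is monic /\ size (monic_cubic a b c) = 4%N.
Proof.
by apply: monic_coefP => [|[|[|[|[|i]]]]] //; rewrite !coefE /= !(mulr0, addr0).
Qed.

Definition size_quintic b := (quintic_spec b).2.
Definition quintic_monic b := (quintic_spec b).1.
Definition size_quadratic s p := (quadratic_spec s p).2.
Definition quadratic_monic s p := (quadratic_spec s p).1.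
Definition size_cubic a b c := (cubic_spec a b c).2.
Definition cubic_monic a b c := (cubic_spec a b c).1.

Lemma root_quintic b x : root (quintic b) x = (x ^+ 5 + x ^+ 3 == b).
Proof.
rewrite rootE !hornerE; apply/eqP/eqP => [/addff_eq //|->]; exact: addff.
Qed.

Lemma monic_size2 (f : {poly F}) : f \is monic -> size f = 2%N -> exists a, f =
  'X - a%:P.
Proof.
move=> /monicP mf sf; exists (- f`_0); apply/polyP => i; rewrite !coefE.
move: mf; rewrite lead_coefE sf /= => f1.
case: i => [|[|i]] /=; rewrite ?(sub0r, opprK, f1, subr0) //.
by rewrite nth_default ?sf ?oppr0.
Qed.

Lemma monic_size3 (f : {poly F}) : f \is monic -> size f = 3%N ->
  f = monic_quadratic f`_1 f`_0.
Proof.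
move=> /monicP mf sf; apply/polyP => i; rewrite !coefE.
move: mf; rewrite lead_coefE sf /= => f2.
case: i => [|[|[|i]]] /=; rewrite ?(mulr0, mulr1, add0r, addr0) //.
by rewrite nth_default ?sf.
Qed.

Lemma monic_size4 (f : {poly F}) : f \is monic -> size f = 4%N ->
  f = monic_cubic f`_2 f`_1 f`_0.
Proof.
move=> /monicP mf sf; apply/polyP => i; rewrite !coefE.
move: mf; rewrite lead_coefE sf /= => f2.
case: i => [|[|[|[|i]]]] /=; rewrite ?(mulr0, mulr1, add0r, addr0) //.
by rewrite nth_default ?sf.
Qed.

Lemma quadratic_mul_cubic s p c2 c1 c0 :
  monic_quadratic s p * monic_cubic c2 c1 c0 =
  'X^5 + (c2 + s)%:P * 'X^4 + (c1 + s * c2 + p)%:P * 'X^3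
  + (c0 + s * c1 + p * c2)%:P * 'X^2 + (s * c0 + p * c1)%:P * 'X + (p * c0)%:P.
Proof. by rewrite /monic_quadratic /monic_cubic; ring. Qed.

Lemma quad_factorM v : quad_param v ->
  quad_factor v * cubic_factor v = quintic (quad_const v).
Proof.
case/and3P => /eqP v0 /eqP v1 /eqP n0.
rewrite quadratic_mul_cubic addff.
rewrite /quad_sum /quad_prod /quad_const /quad_norm in n0 *;
  set n := v ^+ 2 + v + 1.
have -> : 1 + (v / n) ^+ 2 + (v + 1) ^+ 2 / n ^+ 2 + v / n * (v / n) +
  (v + 1) ^+ 2 / n ^+ 2 = 1 by rewrite /n; char2_field.
have -> : v / n * (1 + v / n) ^+ 2 + v / n * (1 + (v / n) ^+ 2 +
  (v + 1) ^+ 2 / n ^+ 2) + (v + 1) ^+ 2 / n ^+ 2 * (v / n) = 0.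
  by rewrite /n; char2_field.
have -> : v / n * (v / n * (1 + v / n) ^+ 2) + (v + 1) ^+ 2 / n ^+ 2 *
  (1 + (v / n) ^+ 2 + (v + 1) ^+ 2 / n ^+ 2) = 0 by rewrite /n; char2_field.
have -> : (v + 1) ^+ 2 / n ^+ 2 * (v / n * (1 + v / n) ^+ 2) =
  v * (v + 1) ^+ 6 / n ^+ 5 by rewrite /n; char2_field.
by rewrite /quintic !mul0r mul1r !addr0.
Qed.

(** The relation is the vanishing of the coefficient of X in the product of the two factors. Divided
    by p^2 it reads (v + 1)^2 = (1 + s)^2 / p, so the curve is rational with parameter v. *)
Lemma quad_param_of_relation s p b : b != 0 -> b = p * s * (1 + s) ^+ 2 ->
  p ^+ 2 + p * (1 + s ^+ 2) + s ^+ 2 + s ^+ 4 = 0 ->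
  let v := s * (1 + s) / p in
  [/\ quad_param v, quad_sum v = s, quad_prod v = p & quad_const v = b].
Proof.
move=> b0 bE rel v; move: b0; rewrite bE mulf_eq0 sqrf_eq0 mulf_eq0 !negb_or.
case/andP=> /andP[p0 s0] s1.
have v1E : (v + 1) ^+ 2 = (1 + s) ^+ 2 / p.
  have -> : (v + 1) ^+ 2 = (1 + s) ^+ 2 / p +
    (p ^+ 2 + p * (1 + s ^+ 2) + s ^+ 2 + s ^+ 4) / p ^+ 2.
    by move/eqP: p0 => p0; rewrite /v; char2_field.
  by rewrite rel mul0r addr0.
have nE : quad_norm v = (1 + s) / p.
  have -> : quad_norm v = (v + 1) ^+ 2 + v by rewrite /quad_norm; char2_ring.
  by rewrite v1E /v; move/eqP: p0 => p0; char2_field.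
have n0 : quad_norm v != 0 by rewrite nE mulf_neq0 ?invr_eq0.
have v10 : v + 1 != 0 by rewrite -sqrf_eq0 v1E mulf_neq0 ?invr_eq0 ?sqrf_eq0.
move/eqP: (p0) => p1; move/eqP: (s1) => s2.
split.
- by rewrite /quad_param n0 v10 !mulf_neq0 ?invr_eq0.
- by rewrite /quad_sum nE /v; char2_field.
- by rewrite /quad_prod nE v1E; char2_field.
- rewrite /quad_const nE; have -> : (v + 1) ^+ 6 = ((v + 1) ^+ 2) ^+ 3.
    by rewrite -exprM.
  by rewrite v1E /v; char2_field.
Qed.

(** The coefficients of X^4, X^3 and X^2 determine the cubic cofactor in terms of s and p; that of X
    gives the relation between s and p. *)
Lemma quad_dvd_quintic s p b : b != 0 -> monic_quadratic s p %| quintic b ->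
  exists2 v, quad_param v & quad_const v = b /\ quad_factor v = monic_quadratic s p.
Proof.
move=> b0 dv.
have [g gE] := dvdpP _ _ dv.
have gm : g \is monic.
  by rewrite -(monicMr _ (quadratic_monic s p)) -gE quintic_monic.
have sg : size g = 4%N.
  move: (size_quintic b); rewrite gE size_monicM ?monic_neq0 ?quadratic_monic //.
  by rewrite size_quadratic addn3 => -[].
move: gE; rewrite (monic_size4 gm sg) mulrC quadratic_mul_cubic.
move: (g`_2 : F) (g`_1 : F) (g`_0 : F) => c2 c1 c0 E.
have c i := congr1 (fun f : {poly F} => f`_i) E.
move: (c 4) (c 3) (c 2) (c 1) (c 0); rewrite /quintic !coefE /=.
rewrite !(mulr0, mulr1, addr0, add0r).
move=> /esym/addff_eq c2E c1E c0E c3E bE; subst c2.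
have {c1E} c1E : c1 = 1 + s ^+ 2 + p.
  by transitivity ((c1 + s * s + p) + s ^+ 2 + p); [char2_ring | rewrite -c1E].
have {c0E} c0E : c0 = s * (1 + s) ^+ 2.
  by move/esym/eqP: c0E; rewrite -addrA => /eqP/addff_eq ->; rewrite c1E;
    char2_ring.
have [||qv sv pv cv] := @quad_param_of_relation s p b b0.
- by rewrite bE c0E; char2_ring.
- by rewrite [RHS]c3E c0E c1E; char2_ring.
by eexists; [exact: qv | rewrite /quad_factor sv pv].
Qed.

(** The parameter is recovered from the coefficients as s (1 + s) / p. *)
Lemma quad_factor_inj (v w : F) : quad_param v -> quad_param w ->
  quad_factor v = quad_factor w -> v = w.
Proof.
have rec u : quad_param u -> u = quad_sum u * (1 + quad_sum u) / quad_prod u.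
  case/and3P => /eqP u0 /eqP u1 /eqP n0.
  have e : 1 + quad_sum u = (u + 1) ^+ 2 / quad_norm u.
    rewrite /quad_sum; transitivity ((quad_norm u + u) / quad_norm u);
      first by char2_field.
    by congr (_ / _); rewrite /quad_norm; char2_ring.
  by rewrite e /quad_sum /quad_prod; char2_field.
move=> qv qw E.
have e i := congr1 (fun f : {poly F} => f`_i) E.
move: (e 1%N) (e 0%N); rewrite /quad_factor /monic_quadratic !coefE /=.
rewrite !(mulr0, mulr1, addr0, add0r) => es ep.
by rewrite (rec v qv) (rec w qw) es ep.
Qed.

(* By p_3 = e_1^3 + e_1 e_2 + e_3 and p_{-1} = e_2 / e_3, the three equations
   determine e_1, e_2, e_3 unless e_1 e_2 + e_3 = (x+y)(x+z)(y+z) vanishes. *)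
Lemma syndrome_root (x y z x' y' z' : F) :
  x != 0 -> y != 0 -> z != 0 -> x' != 0 -> y' != 0 -> z' != 0 ->
  x != y -> x != z -> y != z ->
  x + y + z = x' + y' + z' ->
  x ^+ 3 + y ^+ 3 + z ^+ 3 = x' ^+ 3 + y' ^+ 3 + z' ^+ 3 ->
  x^-1 + y^-1 + z^-1 = x'^-1 + y'^-1 + z'^-1 ->
  (x' + x) * (x' + y) * (x' + z) = 0.
Proof.
move=> /eqP x0 /eqP y0 /eqP z0 /eqP x0' /eqP y0' /eqP z0' xy xz yz e1 p3 t.
set P := (x + y) * (x + z) * (y + z); set P' := (x' + y') * (x' + z') * (y' + z').
have PP : P = P'.
  transitivity (x ^+ 3 + y ^+ 3 + z ^+ 3 + (x + y + z) ^+ 3).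
    by rewrite /P; char2_ring.
  by rewrite e1 p3 /P'; char2_ring.
have P0 : P != 0.
  by rewrite !mulf_neq0 // addr_eq0 oppr_pchar2.
have PE : P = x * y * z * (1 + (x + y + z) * (x^-1 + y^-1 + z^-1)).
  by rewrite /P; char2_field.
have PE' : P' = x' * y' * z' * (1 + (x + y + z) * (x^-1 + y^-1 + z^-1)).
  by rewrite e1 t /P'; char2_field.
have k0 : 1 + (x + y + z) * (x^-1 + y^-1 + z^-1) != 0.
  by apply: contraNneq P0; rewrite PE => ->; rewrite mulr0.
have e3 : x * y * z = x' * y' * z'.
  by apply: (mulIf k0); rewrite -PE -PE'.
(* The two triples share e_1, e_3 and e_2 = e_3 p_{-1}, so x' is a root of the cubic with roots x,
   y, z. *)
transitivity (x' ^+ 3 + (x + y + z) * x' ^+ 2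
    + x * y * z * (x^-1 + y^-1 + z^-1) * x' + x * y * z); first by char2_field.
by rewrite e1 e3 t; char2_field.
Qed.
End Quintic.

(** * Artin-Schreier classes of split factors *)

Section Parity.
Variable F : fieldType.
Hypothesis F2 : 2 \in [pchar F].
Add Field F_field : (field_theory_of F) (morphism (bool_morph F2),
  constants [bool_cst], power_tac (power_theory_of F) [nat_cst]).
Let addff (x : F) : x + x = 0. Proof. exact: addrr_pchar2. Qed.
Let addff_eq (x y : F) : x + y = 0 -> x = y. Proof. exact: char2_addr_eq0. Qed.
Let oppff (x : F) : - x = x. Proof. exact: oppr_pchar2. Qed.

Lemma monic_cubic_split (a b c c2 c1 c0 : F) :
  monic_cubic c2 c1 c0 = ('X - a%:P) * ('X - b%:P) * ('X - c%:P) ->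
  [/\ a + b + c = c2, a * b + a * c + b * c = c1 & a * b * c = c0].
Proof.
have -> : ('X - a%:P) * ('X - b%:P) * ('X - c%:P) =
  monic_cubic (- (a + b + c)) (a * b + a * c + b * c) (- (a * b * c)).
  by rewrite /monic_cubic; ring.
rewrite !oppff => E; have e i := congr1 (fun f : {poly F} => f`_i) E.
move: (e 2) (e 1) (e 0); rewrite /monic_cubic !coefE /=.
by rewrite !(mulr0, mulr1, addr0, add0r) => -> -> ->.
Qed.

Lemma monic_quadratic_XsubC (x y : F) :
  ('X - x%:P) * ('X - y%:P) = monic_quadratic (x + y) (x * y).
Proof. by rewrite -[x + y]oppff /monic_quadratic; ring. Qed.

(** Multiplying the roots by [quad_norm v] clears the denominators of their elementary symmetric
    functions. *)
Lemma cubic_split_artin_schreier v (a b c : F) : quad_param v ->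
  cubic_factor v = ('X - a%:P) * ('X - b%:P) * ('X - c%:P) ->
  artin_schreier (v ^+ 3 + v + 1).
Proof.
case/and3P => v0 v1 n0 /monic_cubic_split [e1 e2 e3].
have n0' : quad_norm v <> 0 by apply/eqP.
apply: (@cubic_parity F F2 (quad_norm v * a) (quad_norm v * b) (quad_norm v * c)
  v v0 v1).
- by rewrite -!mulrDr e1 /quad_sum; char2_field.
- transitivity (quad_norm v ^+ 2 * (a * b + a * c + b * c)); first by char2_ring.
  rewrite e2 /quad_sum /quad_prod.
  transitivity (quad_norm v ^+ 2 + v ^+ 2 + (v + 1) ^+ 2); first by char2_field.
  by rewrite /quad_norm; char2_ring.
- transitivity (quad_norm v ^+ 3 * (a * b * c)); first by char2_ring.
  rewrite e3 /quad_sum; transitivity (v * (quad_norm v + v) ^+ 2);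
    first by char2_field.
  by rewrite /quad_norm; char2_ring.
Qed.

Lemma root_quadratic (s p y : F) :
  root (monic_quadratic s p) y = (y ^+ 2 + s * y + p == 0).
Proof. by rewrite rootE !hornerE. Qed.

(** The substitution y = s z turns y^2 + s y + p = 0 into z^2 + z = p / s^2 = (1 + 1/v)^2. *)
Lemma quad_root_artin_schreier (v y : F) : quad_param v ->
  root (quad_factor v) y -> artin_schreier (1 + v^-1).
Proof.
case/and3P => /eqP v0 _ /eqP n0; rewrite root_quadratic => /eqP ry.
apply: artin_schreier_sqrt => //; exists (quad_norm v * y / v).
transitivity (quad_norm v ^+ 2 / v ^+ 2 * (y ^+ 2 + quad_sum v * y + quad_prod v)
   + (1 + v^-1) ^+ 2).
  by rewrite /quad_sum /quad_prod; char2_field.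
by rewrite ry mulr0 add0r.
Qed.

Lemma artin_schreier_quad_root (v : F) : quad_param v ->
  artin_schreier (1 + v^-1) -> exists y, root (quad_factor v) y.
Proof.
(* The root is s z^2 rather than s z because p / s^2 is the square of 1 + 1/v. *)
case/and3P => /eqP v0 _ /eqP n0 [z zE]; exists (z ^+ 2 * v / quad_norm v).
rewrite root_quadratic; apply/eqP.
transitivity (v ^+ 2 / quad_norm v ^+ 2 * ((z ^+ 2 + z) ^+ 2 + (1 + v^-1) ^+ 2)).
  by rewrite /quad_sum /quad_prod; char2_field.
by rewrite zE addff mulr0.
Qed.

Lemma quad_factor_split (v y : F) : root (quad_factor v) y ->
  quad_factor v = ('X - y%:P) * ('X - (y + quad_sum v)%:P).
Proof.
rewrite root_quadratic => /eqP ry; rewrite monic_quadratic_XsubC.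
rewrite addrA addff add0r; congr (_ + _%:P); apply: addff_eq.
by rewrite -ry; char2_ring.
Qed.

(** Two of the roots form a quadratic factor and the other three its cubic cofactor; [const_parity]
    combines the classes of the two. *)
Lemma quintic_split_artin_schreier b (x1 x2 x3 x4 x5 : F) : b != 0 ->
  quintic b = ('X - x1%:P) * ('X - x2%:P) *
    (('X - x3%:P) * ('X - x4%:P) * ('X - x5%:P)) ->
  artin_schreier (1 + b^-1).
Proof.
move=> b0 E.
have [|v qv [cv fv]] := quad_dvd_quintic F2 b0 (s := x1 + x2) (p := x1 * x2).
  by rewrite E -monic_quadratic_XsubC dvdp_mulr.
have cf : cubic_factor v = ('X - x3%:P) * ('X - x4%:P) * ('X - x5%:P).
  apply: (mulfI (monic_neq0 (quadratic_monic (quad_sum v) (quad_prod v)))).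
  by rewrite [LHS]quad_factorM // cv E monic_quadratic_XsubC -fv.
have AS1 := cubic_split_artin_schreier qv cf.
have AS2 : artin_schreier (1 + v^-1).
  apply: (@quad_root_artin_schreier v x1 qv).
  by rewrite fv -monic_quadratic_XsubC rootM root_XsubC eqxx.
case/and3P: (qv) => v0 v1 n0.
have := artin_schreierD F2 (artin_schreierD F2 (const_parity F2 v0 v1 n0) AS2) AS1.
by rewrite cv; congr artin_schreier; char2_ring.
Qed.
End Parity.

(** * Descent from extensions of odd degree *)

Section OddDegreeDescent.
Variable F : finFieldType.

(** Adjoining one root suffices: extensions of finite fields are normal, so the minimal polynomial
    of that root, which is p, splits. *)
Lemma irreducible_splits (p : {poly F}) : p \is monic -> irreducible_poly p ->
  exists L : fieldExtType F, \dim {:L} = (size p).-1 /\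
    exists rs : seq L, map_poly (in_alg L) p = \prod_(z <- rs) ('X - z%:P).
Proof.
move=> pm irr; have [L dL [z rz _]] := irredp_FAdjoin irr; exists L; split=> //.
have /and3P[_ _ /normalFieldP nF] :=
  @finField_galois F (finvect_type L) 1%AS {:finvect_type L}%AS (sub1v _).
have [rs _ rsE] := nF z (memvf z).
exists rs; rewrite -[RHS]rsE.
have /polyOver1P[q qE] := minPolyOver (1%AS : {subfield L}) z.
have qp : q %| p.
  rewrite -(dvdp_map (in_alg L)) -qE; apply: minPoly_dvdp => //.
  by apply/polyOver1P; exists p.
have sq : size q != 1.
  by rewrite -(size_map_poly (in_alg L)) -qE size_minPoly.
apply/eqP; rewrite -eqp_monic ?map_monic ?monic_minPoly //.
by rewrite [X in _ %= X]qE eqp_map eqp_sym; case: irr => _; apply.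
Qed.

(** A solution z has degree at most 2 over F, and this degree divides an odd number, so z lies in
    F. *)
Lemma artin_schreier_descent (L : fieldExtType F) (a : F) :
  2 \in [pchar F] -> odd (\dim {:L}) ->
  artin_schreier (a%:A : L) -> artin_schreier a.
Proof.
move=> F2 odL [z zE].
have L2 : 2 \in [pchar L] by rewrite pchar_lalg.
set p : {poly F} := 'X^2 + 'X + a%:P.
have sp : size p = 3%N by have := size_quadratic 1 a;
  rewrite /monic_quadratic mul1r.
have rz : root (map_poly (in_alg L) p) z.
  rewrite /p !rmorphD /= map_polyXn map_polyX map_polyC /= rootE !hornerE.
  by rewrite zE addrr_pchar2.
have dvd : minPoly 1 z %| map_poly (in_alg L) p.
  by apply: minPoly_dvdp => //; apply/polyOver1P; exists p.
have : (adjoin_degree 1 z <= 2)%N.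
  rewrite -ltnS -size_minPoly (leq_trans (dvdp_leq _ dvd)) ?size_map_poly ?sp //.
  by rewrite map_poly_eq0 -size_poly_eq0 sp.
have : odd (adjoin_degree 1 z).
  apply: dvdn_odd odL; have := field_dimS (subvf (<<1; z>>%AS : {subfield L})).
  by rewrite dim_Fadjoin dimv1 muln1.
case dz : (adjoin_degree 1 z) => [|[|[|]]] // _ _.
move/eqP: dz; rewrite (adjoin_deg_eq1 1%AS) => /vlineP[k kE].
exists k; apply: (fmorph_inj (in_alg L)); rewrite rmorphD rmorphXn.
by rewrite [RHS]/= -zE kE.
Qed.

(** Frobenius is a 5-cycle on the roots, hence even. Formally, the quintic splits over an extension
    of degree 5, from which the class descends. *)
Lemma irreducible_quintic_artin_schreier (b : F) : 2 \in [pchar F] -> b != 0 ->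
  irreducible_poly (quintic b) -> artin_schreier (1 + b^-1).
Proof.
move=> F2 b0 /(irreducible_splits (quintic_monic b)) [L [dL [rs rsE]]].
rewrite size_quintic in dL.
have L2 : 2 \in [pchar L] by rewrite pchar_lalg.
apply: (@artin_schreier_descent L) => //; first by rewrite dL.
have mE : map_poly (in_alg L) (quintic b) = quintic (b%:A).
  by rewrite /quintic !rmorphD /= !map_polyXn map_polyC.
have := congr1 (fun q : {poly L} => size q) rsE.
rewrite mE size_quintic size_prod_XsubC => -[].
case: rs rsE => [|x1 [|x2 [|x3 [|x4 [|x5 [|]]]]]] // + _.
rewrite mE !big_cons big_nil mulr1 mulrA [X in _ = _ * X]mulrA.
move=> /(quintic_split_artin_schreier L2).
rewrite -in_algE fmorph_eq0 => /(_ b0).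
by rewrite -fmorphV -[1 in X in X -> _](rmorph1 (in_alg L)) -rmorphD.
Qed.

(** A cubic without roots is irreducible, so it splits over an extension of degree 3, from which the
    class descends. *)
Lemma cubic_rootless_artin_schreier (v : F) : 2 \in [pchar F] -> quad_param v ->
  (forall x, ~~ root (cubic_factor v) x) -> artin_schreier (v ^+ 3 + v + 1).
Proof.
move=> F2 qv nr.
have irr : irreducible_poly (cubic_factor v).
  by apply: cubic_irreducible => //; rewrite size_cubic.
have [L [dL [rs rsE]]] := irreducible_splits (cubic_monic _ _ _) irr.
rewrite size_cubic in dL.
have L2 : 2 \in [pchar L] by rewrite pchar_lalg.
have nE : quad_norm (v%:A : L) = in_alg L (quad_norm v).
  by rewrite /quad_norm -in_algE !rmorphD !rmorphXn rmorph1.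
have sE : quad_sum (v%:A : L) = in_alg L (quad_sum v).
  by rewrite /quad_sum nE -in_algE fmorph_div.
have pE : quad_prod (v%:A : L) = in_alg L (quad_prod v).
  by rewrite /quad_prod nE -in_algE fmorph_div !rmorphXn (rmorphD _ v 1) rmorph1.
apply: (@artin_schreier_descent L) => //; first by rewrite dL.
have mE : map_poly (in_alg L) (cubic_factor v) = cubic_factor (v%:A).
  rewrite /cubic_factor sE pE /monic_cubic !(rmorphD, rmorphM) /=.
  rewrite !(map_polyXn, map_polyX, map_polyC) /= -!in_algE.
  by rewrite !(rmorphD, rmorphM, rmorphXn, rmorph1).
have := congr1 (fun q : {poly L} => size q) rsE.
rewrite mE size_cubic size_prod_XsubC => -[].
case: rs rsE => [|x1 [|x2 [|x3 [|]]]] // + _.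
rewrite mE !big_cons big_nil mulr1 mulrA.
move=> /(cubic_split_artin_schreier L2).
have -> : quad_param (v%:A : L).
  case/and3P: qv => v0 v1 n0.
  by rewrite /quad_param nE -in_algE -(rmorph1 (in_alg L))
    -rmorphD !fmorph_eq0 v0 v1.
move=> /(_ isT); congr artin_schreier.
by rewrite -[RHS]/(in_alg L _) !rmorphD rmorphXn rmorph1.
Qed.
End OddDegreeDescent.

(** * The Artin-Schreier character and the score of a quintic *)

Section Character.
Variable F : finFieldType.
Hypothesis F2 : 2 \in [pchar F].
Add Field F_field : (field_theory_of F) (morphism (bool_morph F2),
  constants [bool_cst], power_tac (power_theory_of F) [nat_cst]).
Let addff (x : F) : x + x = 0. Proof. exact: addrr_pchar2. Qed.
Let addff_eq (x y : F) : x + y = 0 -> x = y. Proof. exact: char2_addr_eq0. Qed.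

Definition artin_schreier_set : {set F} := [set z ^+ 2 + z | z : F].
(** This is the additive character (-1)^Tr(x): in characteristic 2 the elements z^2 + z are those of
    trace 0. *)
Definition chi (x : F) : int := if x \in artin_schreier_set then 1 else -1.

Lemma artin_schreier_setP x : reflect (artin_schreier x) (x \in artin_schreier_set).
Proof.
apply: (iffP imsetP) => [[z _ ->]|[z <-]]; first by exists z.
by exists z.
Qed.

Lemma chi1P x : reflect (artin_schreier x) (chi x == 1).
Proof. by rewrite /chi; case: artin_schreier_setP => h; constructor. Qed.

Lemma chi_pm1 x : chi x = 1 \/ chi x = -1.
Proof. by rewrite /chi; case: ifP; [left | right]. Qed.

Lemma artin_schreier_setD x y : x \in artin_schreier_set ->
  (x + y \in artin_schreier_set) = (y \in artin_schreier_set).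
Proof.
move=> /artin_schreier_setP hx.
apply/artin_schreier_setP/artin_schreier_setP => [|hy]; last exact: artin_schreierD.
by move=> /(artin_schreierD F2 hx); rewrite addrA addff add0r.
Qed.

(** The fibers of z -> z^2 + z are the pairs {z, z + 1}. *)
Lemma card_artin_schreier_set : (2 * #|artin_schreier_set| = #|F|)%N.
Proof.
pose f (z : F) := z ^+ 2 + z.
rewrite -[#|F|]sum1_card (partition_big_imset f) /= mulnC -sum_nat_const.
apply: eq_bigr => _ /imsetP[z _ ->].
have z2 : #|[set z; z + 1]| = 2%N.
  by rewrite cards2 -subr_eq0 opprD addrA subrr sub0r oppr_eq0 oner_eq0.
rewrite -[LHS]z2 sum1_card; apply: eq_card => y.
transitivity (y ^+ 2 + y == z ^+ 2 + z); last by [].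
rewrite !inE.
have -> : (y ^+ 2 + y == z ^+ 2 + z) = ((y + z) * (y + (z + 1)) == 0).
  rewrite -subr_eq0 oppr_pchar2 //; congr (_ == 0); char2_ring.
by rewrite mulf_eq0 !addr_eq0 !oppr_pchar2.
Qed.

Lemma card_artin_schreier_setC : #|~: artin_schreier_set| = #|artin_schreier_set|.
Proof. by apply/eqP;
  rewrite -(eqn_add2l #|artin_schreier_set|)
  cardsC -card_artin_schreier_set mul2n addnn. Qed.

(** The set is a subgroup of index 2, so the coset of any x outside it is its whole complement. *)
Lemma chiD x y : chi (x + y) = chi x * chi y.
Proof.
rewrite /chi; case hx : (x \in artin_schreier_set);
  first by rewrite artin_schreier_setD // mul1r.
case hy : (y \in artin_schreier_set);
  first by rewrite addrC artin_schreier_setD // hx mulr1.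
suff : y \in [set x + h | h in artin_schreier_set].
  by case/imsetP => h hh ->; rewrite addrA addff add0r hh.
suff -> : [set x + h | h in artin_schreier_set] =
  ~: artin_schreier_set by rewrite inE hy.
apply/eqP; rewrite eqEcard card_imset; last exact: addrI.
rewrite card_artin_schreier_setC leqnn andbT; apply/subsetP => _ /imsetP[h hh ->].
by rewrite inE addrC artin_schreier_setD // hx.
Qed.

Lemma chi0 : chi 0 = 1.
Proof. by apply/eqP/chi1P; exists 0; rewrite expr0n add0r. Qed.

Lemma chi_sqr_eq1 x : chi x * chi x = 1.
Proof. by rewrite -chiD addff chi0. Qed.

Lemma chi_sqr x : chi (x ^+ 2) = chi x.
Proof.
have /chi1P/eqP : artin_schreier (x ^+ 2 + x) by exact: artin_schreier_sqrD.
by rewrite chiD => h; rewrite -[LHS]mulr1 -(chi_sqr_eq1 x) mulrA h mul1r.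
Qed.

Lemma chi_sqrD z : chi (z ^+ 2 + z) = 1.
Proof. by rewrite chiD chi_sqr chi_sqr_eq1. Qed.

Lemma sum_chi : \sum_x chi x = 0.
Proof.
rewrite (bigID (mem artin_schreier_set)) /=.
rewrite (eq_bigr (fun=> 1)); last by move=> x; rewrite /chi => ->.
rewrite [X in _ + X](eq_bigr (fun=> -1)); last by move=> x;
  rewrite /chi => /negbTE ->.
rewrite !sumr_const -card_artin_schreier_setC -[#|~: _|]cardsE.
rewrite mulNrn; apply/eqP; rewrite subr_eq0; apply/eqP; congr (_ *+ _).
by apply: eq_card => x; rewrite !inE.
Qed.

Lemma sum_chiM y : \sum_x chi (x * y) = if y == 0 then #|F|%:R else 0.
Proof.
case: eqP => [->|/eqP y0].
  by under eq_bigr do rewrite mulr0 chi0; rewrite sumr_const.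
rewrite -[RHS]sum_chi [in RHS](reindex_inj (mulIf y0)) /=. by [].
Qed.

Lemma dvdp_prod_coprime (I : eqType) (s : seq I) (P : I -> {poly F}) f :
  uniq s -> {in s, forall i, P i %| f} ->
  {in s &, forall i j, i != j -> coprimep (P i) (P j)} ->
  \prod_(i <- s) P i %| f.
Proof.
elim: s => [|i s IH] /=; first by rewrite big_nil dvd1p.
move=> /andP[is_ us] dv cp; rewrite big_cons Gauss_dvdp.
  rewrite dv ?mem_head //; apply: IH => // [j js|j k js ks].
    by rewrite dv // inE js orbT.
  by apply: cp; rewrite inE ?js ?ks orbT.
rewrite big_seq; elim/big_rec: _ => [|j p js cpj]; first exact: coprimep1.
rewrite coprimepMr cpj andbT cp ?mem_head ?inE ?js ?orbT //.
by apply: contraNneq is_ => ->.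
Qed.

(** The derivative is X^2 (X + 1)^2, and its zeros 0 and 1 are roots of the quintic only when b =
    0. *)
Lemma quintic_root_simple (b x : F) (h : {poly F}) : b != 0 ->
  quintic b = h * ('X - x%:P) -> ~~ root h x.
Proof.
move=> b0 E; apply/negP => /rootP hx.
have rx : root (quintic b) x by rewrite E rootM root_XsubC eqxx orbT.
have := congr1 (fun f : {poly F} => f^`().[x]) E.
rewrite derivM derivXsubC mulr1 hornerD hornerM hornerXsubC subrr mulr0 add0r hx.
rewrite /quintic !derivE !hornerE /= => d0.
have : x ^+ 2 * (x + 1) ^+ 2 = 0 by rewrite -[RHS]d0; char2_ring.
move/eqP; rewrite mulf_eq0 !sqrf_eq0 => x01.
move: b0; rewrite -(eqP (etrans (esym (root_quintic F2 b x)) rx)).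
case/orP: x01 => [/eqP ->|/eqP/addff_eq ->].
  by rewrite !expr0n addr0 eqxx.
by rewrite !expr1n addff eqxx.
Qed.

(** * Roots and quadratic factors of the quintic *)

Definition roots (b : F) : {set F} := [set x | x ^+ 5 + x ^+ 3 == b].
(** For b != 0 these parameters correspond one to one to the monic quadratic divisors of the
    quintic, by [quad_dvd_quintic] and [quad_factor_inj]. *)
Definition quads (b : F) : {set F} := [set v | quad_param v && (quad_const v == b)].
Definition irr_quads b : {set F} := [set v in quads b | chi (1 + v^-1) == -1].
Definition split_quads b : {set F} := [set v in quads b | chi (1 + v^-1) == 1].

Lemma mem_roots b x : (x \in roots b) = root (quintic b) x.
Proof. by rewrite inE root_quintic. Qed.

Lemma quads_dvd b v : v \in quads b -> quad_factor v %| quintic b.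
Proof. by rewrite inE => /andP[qv /eqP <-]; rewrite -quad_factorM // dvdp_mulr. Qed.

Lemma quad_size (v : F) : size (quad_factor v)
  = 3%N. Proof. exact: size_quadratic. Qed.

Lemma quad_monic (v : F)
  : quad_factor v \is monic. Proof. exact: quadratic_monic. Qed.

Lemma irr_quads_rootless b v x : v \in irr_quads b -> ~~ root (quad_factor v) x.
Proof.
rewrite !inE => /andP[/andP[qv _] /eqP cv];
  apply/negP => /(quad_root_artin_schreier F2 qv).
by move/chi1P; rewrite cv.
Qed.

Lemma irr_quads_irreducible b v : v \in irr_quads b ->
  irreducible_poly (quad_factor v).
Proof.
by move=> iv; apply: cubic_irreducible => [|x];
  rewrite ?quad_size ?(irr_quads_rootless x iv).
Qed.

Lemma card_quads b : #|quads b| = (#|split_quads b| + #|irr_quads b|)%N.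
Proof.
rewrite -(cardsID (split_quads b) (quads b)); congr (_ + _)%N; apply: eq_card => v.
  by rewrite !inE; case: (quad_param v && _); rewrite ?andbF.
rewrite !inE; case: (quad_param v && _); rewrite ?andbF //=.
by case: (chi_pm1 (1 + v^-1)) => ->.
Qed.

Lemma sum_chi_quads b : \sum_(v in quads b) chi (1 + v^-1) =
  #|split_quads b|%:Z - #|irr_quads b|%:Z.
Proof.
rewrite (bigID (fun v => chi (1 + v^-1) == 1)) /=.
rewrite (eq_bigr (fun=> 1)); last by move=> v /andP[_ /eqP].
rewrite [X in _ + X](eq_bigr (fun=> -1)); last first.
  by move=> v /andP[_]; case: (chi_pm1 (1 + v^-1)) => ->.
rewrite !sumr_const mulNrn !natz; congr (_%:Z - _%:Z); apply: eq_card => v.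
  by rewrite [LHS]unfold_in [in RHS]inE.
rewrite [LHS]unfold_in [in RHS]inE /=; congr (_ && _).
by case: (chi_pm1 (1 + v^-1)) => ->.
Qed.

(** Sending a split quadratic factor to its root set is a bijection onto the pairs of distinct
    roots. *)
Lemma card_split_quads (b : F) : b != 0 -> #|split_quads b| = 'C(#|roots b|, 2).
Proof.
move=> b0; pose rs (v : F) := [set x : F | root (quad_factor v) x].
have rsE v : v \in split_quads b ->
    #|rs v| = 2%N /\ quad_factor v = \prod_(x in rs v) ('X - x%:P).
  rewrite !inE => /andP[/andP[qv _] /chi1P/(artin_schreier_quad_root F2 qv)[y ry]].
  have s0 : quad_sum v != 0.
    by case/and3P: qv => v0 _ n0; rewrite mulf_neq0 ?invr_eq0.
  have yne : y != y + quad_sum v by rewrite -subr_eq0 opprD addrA subrr sub0r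
    oppr_eq0.
  have E := quad_factor_split F2 ry.
  have -> : rs v = [set y; y + quad_sum v].
    by apply/setP => x; rewrite !inE E rootM !root_XsubC.
  by rewrite cards2 yne big_setU1 ?inE //= big_set1.
have inj : {in split_quads b &, injective rs}.
  move=> v w sv sw e; apply: (quad_factor_inj F2).
  - by move: sv; rewrite !inE => /andP[/andP[]].
  - by move: sw; rewrite !inE => /andP[/andP[]].
  by rewrite (rsE _ sv).2 (rsE _ sw).2 e.
rewrite -(card_in_imset inj) -cards_draws; congr #|pred_of_set _|.
apply/setP => B; rewrite [RHS]inE; apply/imsetP/andP => [[v sv ->]|[sB /eqP cB]].
  rewrite (rsE _ sv).1; split=> //; apply/subsetP => x;
    rewrite inE mem_roots -!dvdp_XsubCl.
  by move/dvdp_trans; apply; apply: quads_dvd; move: sv; rewrite inE => /andP[].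
have [x [y [xy BE]]] := cards2P _ (introT eqP cB).
have [rx ry] : root (quintic b) x /\ root (quintic b) y.
  by rewrite -!mem_roots; split; apply: (subsetP sB); rewrite BE !inE eqxx ?orbT.
have dv : monic_quadratic (x + y) (x * y) %| quintic b.
  rewrite -monic_quadratic_XsubC // Gauss_dvdp ?dvdp_XsubCl ?rx ?ry //.
  by rewrite coprimep_XsubC root_XsubC eq_sym.
have [v qv [cv fv]] := quad_dvd_quintic F2 b0 dv.
have rxy z : root (quad_factor v) z = (z == x) || (z == y).
  by rewrite fv -monic_quadratic_XsubC // rootM !root_XsubC.
exists v; last by apply/setP => z; rewrite BE !inE rxy.
rewrite !inE qv cv eqxx /=; apply/chi1P.
by apply: (@quad_root_artin_schreier _ F2 v x qv); rewrite rxy eqxx.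
Qed.

(** Distinct linear and irreducible quadratic factors are coprime, so their product divides the
    quintic. The number 6 is the size of the quintic, one more than its degree. *)
Lemma quintic_residual (b : F) : b != 0 -> exists g : {poly F},
  [/\ g \is monic, (size g + (#|roots b| + 2 * #|irr_quads b|) = 6)%N,
      forall x, ~~ root g x &
      quintic b = g * \prod_(x in roots b) ('X - x%:P) *
                  \prod_(v in irr_quads b) quad_factor v].
Proof.
move=> b0.
set D1 := \prod_(x in roots b) ('X - x%:P); set D2 := \prod_(v in _) quad_factor v.
have D1m : D1 \is monic by apply: monic_prod_XsubC.
have D2m : D2 \is monic by apply: monic_prod => v _; exact: quad_monic.
have d1 : D1 %| quintic b.
  rewrite /D1 -big_enum /=; apply: uniq_roots_dvdp;
    last by rewrite uniq_rootsE enum_uniq.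
  by apply/allP => x; rewrite mem_enum mem_roots.
have d2 : D2 %| quintic b.
  rewrite /D2 -big_enum /=; apply: dvdp_prod_coprime; first exact: enum_uniq.
    by move=> v; rewrite mem_enum inE => /andP[/quads_dvd].
  move=> v w; rewrite !mem_enum => iv iw vw.
  rewrite (irreducible_poly_coprime _ (irr_quads_irreducible iv)).
  apply: contra vw => /dvdp_size_eqp; rewrite !quad_size eqxx => /esym.
  rewrite eqp_monic ?quad_monic // => /eqP/(quad_factor_inj F2) -> //.
  - by move: iv; rewrite !inE => /andP[/andP[]].
  - by move: iw; rewrite !inE => /andP[/andP[]].
have cD : coprimep D1 D2.
  rewrite coprimep_sym /D1; elim/big_rec: _ => [|x p _ cp]; first exact: coprimep1.
  rewrite coprimepMr cp andbT coprimep_XsubC /D2.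
  elim/big_rec: _ => [|v w iv nw]; first by rewrite root1.
  by rewrite rootM negb_or (irr_quads_rootless x iv).
have /dvdpP[g gE] : D1 * D2 %| quintic b by rewrite Gauss_dvdp // d1.
exists g; have gm : g \is monic.
  by rewrite -(monicMr _ (rpredM D1m D2m)) -gE quintic_monic.
have sD1 : size D1 = #|roots b|.+1.
  by rewrite /D1 -big_enum size_prod_XsubC -cardE.
have sD2 : size D2 = (2 * #|irr_quads b|).+1.
  rewrite size_prod => [|v _]; last by rewrite monic_neq0 ?quad_monic.
  rewrite (eq_bigr (fun=> 3%N)) => [|v _]; last exact: quad_size.
  have e n : ((n * 3).+1 - n = (2 * n).+1)%N by lia.
  by rewrite sum_nat_const e.
split=> //; last by rewrite -mulrA.
- have := size_quintic b; rewrite gE !size_monicM ?monic_neq0 ?rpredM //.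
  have : (0 < size g)%N by rewrite size_poly_gt0 monic_neq0.
  rewrite sD1 sD2; case: (size g) => [//|k] _;
    move: #|roots b| #|irr_quads b| => l n.
  by rewrite !(addSn, addnS) /= => -[] <-; rewrite !addnA.
move=> x; apply/negP => gx.
have xr : x \in roots b by rewrite mem_roots gE rootM gx.
have [h hE] := factor_theorem g x gx.
(* A root x of g would be a double root of the quintic. *)
have : root (h * (\prod_(y in roots b | y != x) ('X - y%:P) * D2 * ('X - x%:P))) x.
  by rewrite !rootM root_XsubC eqxx !orbT.
apply/negP; apply: quintic_root_simple b0 _.
rewrite gE hE /D1 (bigD1 x) //=; ring.
Qed.

(** * The sign of Frobenius and the score *)

Definition parity (b : F) : int := chi (1 + b^-1).

(** The sign is the product of those of the two factors: -1 for the irreducible quadratic, 1 for the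
    cubic. *)
Lemma irr_quad_parity (b v : F) : v \in irr_quads b ->
  artin_schreier (v ^+ 3 + v + 1) -> parity b = -1.
Proof.
rewrite !inE => /andP[/andP[qv /eqP cv] /eqP nv] /chi1P/eqP c1.
case/and3P: qv => v0 v1 n0; have /chi1P/eqP := const_parity F2 v0 v1 n0.
rewrite 2!chiD cv -/(parity b) c1 mulr1 nv mulrN1.
by move=> /eqP; rewrite eqr_oppLR => /eqP.
Qed.

Lemma no_quads_root (b : F) (q : {poly F}) : b != 0 -> q %| quintic b ->
  roots b = set0 -> irr_quads b = set0 -> size q != 2%N /\ size q != 3%N.
Proof.
move=> b0 dq r0 i0.
have q0 : q != 0.
  by apply: contraTneq dq => ->; rewrite dvd0p monic_neq0 ?quintic_monic.
have lq : lead_coef q != 0 by rewrite lead_coef_eq0.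
pose q1 := (lead_coef q)^-1 *: q.
have m1 : q1 \is monic by rewrite monicE lead_coefZ mulVf.
have d1 : q1 %| quintic b by rewrite dvdpZl ?invr_eq0.
have s1 : size q1 = size q by rewrite size_scale ?invr_eq0.
rewrite -s1; split; apply/negP => /eqP sq.
  have [a aE] := monic_size2 m1 sq.
  by move: d1; rewrite aE dvdp_XsubCl -mem_roots r0 inE.
have e := monic_size3 m1 sq; rewrite e in d1.
have [v qv [cv _]] := quad_dvd_quintic F2 b0 d1.
have : v \in quads b by rewrite inE qv cv eqxx.
have : #|quads b| = 0%N by rewrite card_quads card_split_quads // r0 i0 !cards0.
by move/eqP; rewrite cards_eq0 => /eqP ->; rewrite inE.
Qed.

(** In a proper factorization of a quintic one factor has degree 1 or 2, which [no_quads_root]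
    excludes. Hence the quintic is irreducible. *)
Lemma parity_irreducible (b : F) : b != 0 ->
  roots b = set0 -> irr_quads b = set0 -> parity b = 1.
Proof.
move=> b0 r0 i0; apply/eqP/chi1P.
apply: irreducible_quintic_artin_schreier => //; split;
  first by rewrite size_quintic.
move=> q s1 dq.
have /dvdpP[h hE] := dq.
have [] := no_quads_root b0 dq r0 i0.
have dh : h %| quintic b by rewrite hE dvdp_mulr.
have [] := no_quads_root b0 dh r0 i0.
have := size_quintic b; have f0 : h * q != 0.
  by rewrite -hE monic_neq0 ?quintic_monic.
move: (f0); rewrite mulf_eq0 negb_or => /andP[h0 q0].
rewrite hE size_mul // => sE h2 h3 q2 q3.
suff sq : size q = 6%N.
  by rewrite -dvdp_size_eqp ?dvdp_mull // -hE size_quintic sq.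
move: h0 q0; rewrite -!size_poly_gt0.
move: (size q) (size h) s1 sE h2 h3 q2 q3 => k l.
case: k => [|[|[|[|[|[|k]]]]]] //; case: l => [|[|[|[|[|l]]]]] //=;
  rewrite ?addnS ?addn0 //=; lia.
Qed.

(** The roots all belong to the cubic cofactor, which therefore is irreducible or splits; Frobenius
    is even on its roots in both cases. *)
Lemma irr_quad_root_parity (b v : F) : b != 0 -> v \in irr_quads b ->
  #|roots b| = 0%N \/ #|roots b| = 3%N -> parity b = -1.
Proof.
move=> b0 iv rb; apply: (irr_quad_parity iv).
have := iv; rewrite !inE => /andP[/andP[qv /eqP cv] _].
have fE := quad_factorM F2 qv; rewrite cv in fE.
case: rb => [r0|r3].
  apply: cubic_rootless_artin_schreier => // x; apply/negP => rx.
  have : x \in roots b by rewrite mem_roots -fE rootM rx orbT.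
  by move/eqP: r0; rewrite cards_eq0 => /eqP ->; rewrite inE.
have : size (enum (roots b)) = 3%N by rewrite -cardE.
have := quintic_residual b0 => -[g [_ _ _ _]].
have : uniq_roots (enum (roots b)) by rewrite uniq_rootsE enum_uniq.
have : all (root (cubic_factor v)) (enum (roots b)).
  apply/allP => x; rewrite mem_enum mem_roots -fE rootM.
  by rewrite (negbTE (irr_quads_rootless x iv)).
case: (enum _) => [|x1 [|x2 [|x3 [|]]]] // al un _.
have := all_roots_prod_XsubC _ al un; rewrite size_cubic => /(_ erefl).
rewrite (monicP (cubic_monic _ _ _)) scale1r !big_cons big_nil mulr1 mulrA.
exact: cubic_split_artin_schreier.
Qed.

(* The regular character of S_5 at Frobenius: 120 if the quintic splits and 0
   otherwise (only <= 0 is proved in the second case).  Here r = #roots,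
   p = #quads, and the sum of chi is the number of split minus the number of
   irreducible quadratic factors. *)
Definition score (b : F) : int :=
  3 - 7 * #|roots b|%:Z + 5 * #|quads b|%:Z
  + 6 * (\sum_(v in quads b) chi (1 + v^-1))
  + parity b * (5 * #|quads b|%:Z - #|roots b|%:Z - 3).

(** With r roots and i irreducible quadratic factors, the residual factor has degree 5 - r - 2i. It
    is never linear, and it is quadratic only if i > 0. This leaves few pairs (r, i), and the parity
    is known for r = 0 and for r = 3. *)
Lemma score_le0 (b : F) : b != 0 -> #|roots b| <> 5%N -> score b <= 0.
Proof.
move=> b0 r5; have [g [gm sg gr fE]] := quintic_residual b0.
have g2 : size g != 2%N.
  by apply/negP => /eqP/(monic_size2 gm)[a aE]; have := gr a;
    rewrite aE root_XsubC eqxx.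
have g3 : size g = 3%N -> #|irr_quads b| != 0%N.
  move=> s3; have gE := monic_size3 gm s3.
  have dg : monic_quadratic g`_1 g`_0 %| quintic b.
    by rewrite -gE fE -mulrA dvdp_mulr.
  have [v qv [cv fv]] := quad_dvd_quintic F2 b0 dg.
  rewrite -lt0n; apply/card_gt0P; exists v; rewrite !inE qv cv eqxx /=.
  case: (chi_pm1 (1 + v^-1)) => [/eqP/chi1P|->] //.
  case/(artin_schreier_quad_root F2 qv) => x.
  by rewrite fv -gE (negbTE (gr x)).
have gt0 : (0 < size g)%N by rewrite size_poly_gt0 monic_neq0.
have par : (0 < #|irr_quads b|)%N -> #|roots b| = 0%N \/ #|roots b| = 3%N ->
    parity b = -1.
  by move=> /card_gt0P[v iv]; exact: (irr_quad_root_parity b0 iv).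
have par0 : #|roots b| = 0%N -> #|irr_quads b| = 0%N -> parity b = 1.
  move=> /eqP + /eqP; rewrite !cards_eq0 => /eqP r0 /eqP i0.
  exact: parity_irreducible.
rewrite /score sum_chi_quads card_quads card_split_quads //.
have := chi_pm1 (1 + b^-1); rewrite -/(parity b).
have : (#|roots b| <= 5)%N by lia.
move: (size g) sg g2 g3 gt0 par par0 r5 => k.
move: (parity b) #|irr_quads b| #|roots b| => e i r.
case: r => [|[|[|[|[|[|]]]]]] // sg k2 k3 k0 p0 p1 _ _;
  case: i sg k3 p0 p1 => [|[|[|i]]] sg k3 p0 p1; rewrite /binomial /= => -[] eE;
  rewrite {}eE in p0 p1 *; lia.
Qed.
End Character.

(** * Moments and the counting argument *)

(** In the application s is minus the mixed sum and e the absolute value of the cubic sum.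
    Successively e <= q/128, s >= 0.195 q and s^2 - 3q + 5 >= 0.038 q^2. The last hypothesis then
    yields q <= 6 / 0.00741^2 < 109300 < 2^17. *)
Lemma numeric_contradiction (R : realDomainType) (q s e : R) : 2 ^+ 17 <= q ->
  0 <= e ->
  e ^+ 2 <= 4 * q -> q - 53 - 5 * s - e <= 0 ->
  (s * (s ^+ 2 - 3 * q + 5)) ^+ 2 <= 6 * q ^+ 5 -> False.
Proof.
move=> q_ge e0 e_le s_ge X_le.
have q0 : 0 < q by apply: lt_le_trans q_ge; rewrite exprn_gt0.
have e_le' : 128 * e <= q.
  rewrite -(@ler_pXn2r _ 2) ?nnegrE ?mulr_ge0 ?(ltW q0) //.
  apply: (@le_trans _ _ (2 ^+ 16 * q)); first by rewrite exprMn; lra.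
  by rewrite [leRHS]expr2 ler_pM2r //; lra.
have s_ge' : 39 * q <= 200 * s by lra.
have Y_ge : 19 * q ^+ 2 <= 500 * (s ^+ 2 - 3 * q + 5).
  have : (39 * q) ^+ 2 <= (200 * s) ^+ 2.
    by rewrite ler_pXn2r // nnegrE; lra.
  have : 2 ^+ 17 * q <= q ^+ 2 by rewrite [leRHS]expr2 ler_pM2r.
  rewrite !exprMn; lra.
have X_ge : 741 * q ^+ 3 <= 200 * 500 * (s * (s ^+ 2 - 3 * q + 5)).
  have -> : 741 * q ^+ 3 = (39 * q) * (19 * q ^+ 2) by ring.
  have -> : 200 * 500 * (s * (s ^+ 2 - 3 * q + 5)) =
    (200 * s) * (500 * (s ^+ 2 - 3 * q + 5)) by ring.
  by apply: ler_pM => //; rewrite mulr_ge0 ?exprn_ge0 ?(ltW q0).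
move: (s * _) X_ge X_le => X X_ge X_le.
have X2_ge : (741 * q ^+ 3) ^+ 2 <= (200 * 500 * X) ^+ 2.
  have q3 : 0 < q ^+ 3 by rewrite exprn_gt0.
  by rewrite ler_pXn2r ?nnegrE //; lra.
have : 741 ^+ 2 * q <= (200 * 500) ^+ 2 * 6.
  rewrite -(ler_pM2r (exprn_gt0 5 q0)).
  have -> : 741 ^+ 2 * q * q ^+ 5 = (741 * q ^+ 3) ^+ 2 by ring.
  apply: le_trans X2_ge _; rewrite [leLHS]exprMn -[leRHS]mulrA ler_pM2l //.
  by rewrite exprn_gt0 ?mulr_gt0.
by lra.
Qed.

Section SumIdentities.
Variable F : finFieldType.

Lemma sum_fibers (h : F -> F) (P : pred F) (G : F -> F -> int) :
  \sum_(b | b != 0) \sum_(x in [set x | P x && (h x == b)]) G b x =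
  \sum_(x | P x && (h x != 0)) G (h x) x.
Proof.
rewrite [RHS](partition_big h (fun b => b != 0)) => [|x /andP[]//].
apply: eq_bigr => b b0; apply: eq_big => x; last by rewrite inE => /andP[_ /eqP ->].
by rewrite inE -andbA; case: eqP => [->|]; rewrite ?b0 ?andbF.
Qed.

Lemma sum_card_fibers (h : F -> F) (P : pred F) (w : F -> int) :
  \sum_(b | b != 0) w b * #|[set x | P x && (h x == b)]|%:Z =
  \sum_(x | P x && (h x != 0)) w (h x).
Proof.
rewrite -(sum_fibers h P (fun b _ => w b)); apply: eq_bigr => b _.
by rewrite sumr_const -mulr_natr natz.
Qed.

(** For fixed x, the sum over distinct y and z is the square of S - g(x) minus the N - 1 diagonal
    terms g(y)^2 = 1. Then g(x)^3 = g(x) makes the sum over x linear in g. *)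
Lemma sum_distinct_triples (g : F -> int) (P : pred F) :
  (forall x, P x -> g x * g x = 1) ->
  \sum_(t : F * F * F | [&& P t.1.1, P t.1.2, P t.2,
      t.1.1 != t.1.2, t.1.1 != t.2 & t.1.2 != t.2]) g t.1.1 * g t.1.2 * g t.2 =
  (\sum_(x | P x) g x) ^+ 3
  - (3 * (\sum_(x | P x) 1) - 2) * \sum_(x | P x) g x.
Proof.
move=> g1; set S := \sum_(x | P x) g x; set N := \sum_(x | P x) 1.
have S1 x : P x -> \sum_(y | P y && (y != x)) g y = S - g x.
  by move=> Px; rewrite /S [in RHS](bigD1 x) //= addrAC subrr add0r.
have N1 x : P x -> \sum_(y | P y && (y != x)) 1 = N - 1.
  by move=> Px; rewrite /N [in RHS](bigD1 x) //= addrAC subrr add0r.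
have S2 x y : P x -> P y && (y != x) ->
    \sum_(z | [&& P z, z != x & z != y]) g z = S - g x - g y.
  move=> Px /andP[Py yx]; rewrite -(S1 x Px) [in RHS](bigD1 y) /= ?Py //.
  by rewrite addrAC subrr add0r; apply: eq_bigl => z; rewrite andbA.
transitivity (\sum_(x | P x) \sum_(y | P y && (y != x))
    \sum_(z | [&& P z, z != x & z != y]) g x * g y * g z).
  rewrite pair_big_dep pair_big_dep /=; apply: eq_bigl => -[[x y] z] /=.
  rewrite [y == x]eq_sym [z == x]eq_sym [z == y]eq_sym.
  by do 3![case: (P _) => //=]; rewrite ?andbF.
transitivity (\sum_(x | P x) g x * ((S - g x) ^+ 2 - (N - 1))).
  apply: eq_bigr => x Px;
    rewrite -(N1 x Px) expr2 -{1}(S1 x Px) mulr_suml -sumrB mulr_sumr.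
  apply: eq_bigr => y Py; rewrite -mulr_sumr S2 //.
  have /andP[/g1 gy _] := Py.
  by transitivity (g x * (g y * (S - g x) - g y * g y)); [ring | rewrite gy].
transitivity (\sum_(x | P x) ((S ^+ 2 + 2 - N) * g x - 2 * S * 1)).
  apply: eq_bigr => x Px; have gx := g1 x Px.
  transitivity (S ^+ 2 * g x - 2 * S * (g x * g x) + (g x * g x) * g x - (N - 1)
    * g x).
    by ring.
  by rewrite gx; ring.
rewrite sumrB -!mulr_sumr -/S -/N; ring.
Qed.
End SumIdentities.

Section Estimates.
Variable F : finFieldType.
Hypothesis F2 : 2 \in [pchar F].
Add Field F_field : (field_theory_of F) (morphism (bool_morph F2),
  constants [bool_cst], power_tac (power_theory_of F) [nat_cst]).
Local Notation q := (#|F|%:Z).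
Let addff (x : F) : x + x = 0. Proof. exact: addrr_pchar2. Qed.
Let addff_eq (x y : F) : x + y = 0 -> x = y. Proof. exact: char2_addr_eq0. Qed.

Definition cubic_sum : int := \sum_(x : F) chi (x ^+ 3 + x).

(* Squaring and substituting y = x + t^2, the sum over x becomes linear because
   chi(a^2) = chi(a). *)
Lemma cubic_sum_sqr : cubic_sum ^+ 2 <= 4 * q.
Proof.
pose f (x : F) := x ^+ 3 + x.
have E : cubic_sum ^+ 2 = \sum_(t : F | t + t ^+ 4 == 0) chi (f (t ^+ 2)) * q.
  transitivity (\sum_(x : F) \sum_(t : F) chi (f x) * chi (f (x + t ^+ 2))).
    rewrite expr2 {1}/cubic_sum mulr_suml; apply: eq_bigr => x _.
    rewrite -mulr_sumr; congr (_ * _);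
      rewrite /cubic_sum (reindex_inj (h := fun t => x + t ^+ 2)) //.
    by move=> s t /addrI e; apply: (fmorph_inj (pFrobenius_aut F2)); exact: e.
  rewrite exchange_big [RHS]big_mkcond; apply: eq_bigr => t _ /=.
  transitivity (\sum_(x : F) chi (f (t ^+ 2)) * chi (x * (t + t ^+ 4))).
    apply: eq_bigr => x _; rewrite -!chiD //.
    have -> : f x + f (x + t ^+ 2) = f (t ^+ 2) + x * (t + t ^+ 4) + ((x * t)
      ^+ 2 + x * t).
      by rewrite /f; char2_ring.
    by rewrite (chiD F2 _ ((x * t) ^+ 2 + x * t)) (chi_sqrD F2) mulr1.
  by rewrite -mulr_sumr sum_chiM //; case: eqP => _; rewrite ?mulr0 ?natz.
rewrite E; apply: (@le_trans _ _ (\sum_(t : F | t + t ^+ 4 == 0) 1 * q)).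
  apply: ler_sum => t _; apply: ler_wpM2r; first by [].
  by case: (chi_pm1 (f (t ^+ 2))) => ->.
rewrite -mulr_suml sumr_const ler_wpM2r // (ler_nat _ _ 4).
have p0 : ('X + 'X^4 : {poly F}) != 0.
  apply/eqP => /(congr1 (fun p : {poly F} => p`_4));
    rewrite !coefE /= add0r => /eqP.
  by rewrite oner_eq0.
pose A := [pred t : F | t + t ^+ 4 == 0].
have : (size (enum A) < size ('X + 'X^4 : {poly F})%R)%N.
  apply: max_poly_roots => //; last exact: enum_uniq.
  by apply/allP => t; rewrite mem_enum inE rootE !hornerE.
by rewrite addrC size_polyDl ?size_polyXn ?size_polyX // -cardE.
Qed.

(** * The third moment of the mixed sum *)

Definition mixed_sum : int := \sum_(x : F | x != 0) chi (x ^+ 3 + x + x^-1).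
Definition distinct3 (t : F * F * F) := [&& t.1.1 != 0, t.1.2 != 0, t.2 != 0,
  t.1.1 != t.1.2, t.1.1 != t.2 & t.1.2 != t.2].
Definition syndrome (t : F * F * F) : F * F * F :=
  (t.1.1 ^+ 3 + t.1.2 ^+ 3 + t.2 ^+ 3, t.1.1 + t.1.2 + t.2,
   t.1.1^-1 + t.1.2^-1 + t.2^-1).
Definition dot3 (a s : F * F * F) := a.1.1 * s.1.1 + a.1.2 * s.1.2 + a.2 * s.2.
(** The Fourier transform on F^3 of the number of distinct triples with a given syndrome. *)
Definition triple_sum (a : F * F * F) : int :=
  \sum_(t | distinct3 t) chi (dot3 a (syndrome t)).

Lemma sum_dot3 (s : F * F * F) :
  \sum_a chi (dot3 a s) = if s == (0, 0, 0) then q ^+ 3 else 0.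
Proof.
transitivity ((\sum_x chi (x * s.1.1)) * (\sum_x chi (x * s.1.2))
  * (\sum_x chi (x * s.2))).
  rewrite big_distrlr pair_bigA big_distrlr pair_bigA.
  apply: eq_bigr => -[[a b] c] _ /=.
  by rewrite /dot3 !chiD.
rewrite !sum_chiM // !natz; case: s => [[a b] c]; rewrite !xpair_eqE /=.
case: eqP => _; last by rewrite !mul0r.
case: eqP => _; last by rewrite mulr0 mul0r.
by case: eqP => _; rewrite ?mulr0 // -!expr2 -exprSr.
Qed.

(** By [syndrome_root] every entry of the second triple is one of x, y, z, so distinct entries form
    one of the 6 permutations. *)
Lemma card_syndrome_fiber (t : F * F * F) : distinct3 t ->
  (#|[pred u | distinct3 u && (syndrome u == syndrome t)]| <= 6)%N.
Proof.
case: t => [[x y] z] dt.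
pose s := [:: (x, y, z); (x, z, y); (y, x, z); (y, z, x); (z, x, y); (z, y, x)].
apply: (@leq_trans #|s|); last exact: card_size.
apply: subset_leq_card; apply/subsetP => -[[x' y'] z']; rewrite inE => /andP[].
move: dt => /and5P[/= x0 y0 z0 xy /andP[xz yz]].
move=> /and5P[/= x0' y0' z0' xy' /andP[xz' yz']] /eqP[e3 e1 e_].
have rt u : (u + x) * (u + y) * (u + z) = 0 -> [|| u == x, u == y | u == z].
  by move/eqP; rewrite !mulf_eq0 !addr_eq0 !oppr_pchar2 // -orbA.
have hx : [|| x' == x, x' == y | x' == z].
  by apply/rt/(syndrome_root F2 (y' := y') (z' := z')).
have hy : [|| y' == x, y' == y | y' == z].
  apply/rt/(syndrome_root F2 (y' := x') (z' := z')) => //; first by rewrite -e1;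
    ring.
    by rewrite -e3; ring.
  by rewrite -e_; ring.
have hz : [|| z' == x, z' == y | z' == z].
  apply/rt/(syndrome_root F2 (y' := x') (z' := y')) => //; first by rewrite -e1;
    ring.
    by rewrite -e3; ring.
  by rewrite -e_; ring.
rewrite !inE !xpair_eqE.
move: xy' xz' yz'.
case/or3P: hx => /eqP->; case/or3P: hy => /eqP->; case/or3P: hz => /eqP->;
  by rewrite ?eqxx ?orbT.
Qed.

(** The bound keeps a factor q - 1, to be cancelled against the number of parameters k in
    [triple_sum_bound]. *)
Lemma card_distinct3 : (#|[pred t | distinct3 t]| <= #|F|.-1 * #|F| ^ 2)%N.
Proof.
apply: (@leq_trans #|setX (setX [set~ (0 : F)] setT) (setT : {set F})|).
  apply: subset_leq_card; apply/subsetP => -[[x y] z]; rewrite !inE /=.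
  by case/and5P => ->.
by rewrite !cardsX cardsC1 !cardsT -mulnA.
Qed.

(** Parseval: expanding the square and summing over a leaves the pairs of triples with equal
    syndromes, each with weight q^3. *)
Lemma sum_triple_sum_sqr :
  \sum_a triple_sum a ^+ 2 <= 6 * q ^+ 3 * ((q - 1) * q ^+ 2).
Proof.
have -> : \sum_a triple_sum a ^+ 2 =
    \sum_(t | distinct3 t) \sum_(u | distinct3 u && (syndrome u == syndrome t))
      q ^+ 3.
  transitivity (\sum_a \sum_(t | distinct3 t) \sum_(u | distinct3 u)
      chi (dot3 a (syndrome t)) * chi (dot3 a (syndrome u))).
    apply: eq_bigr => a _; rewrite expr2 mulr_suml; apply: eq_bigr => t _.
    by rewrite mulr_sumr.
  rewrite exchange_big; apply: eq_bigr => t _;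
    rewrite exchange_big [RHS]big_mkcondr /=.
  apply: eq_bigr => u _; pose w := syndrome u + syndrome t.
  transitivity (\sum_a chi (dot3 a w)).
    by apply: eq_bigr => a _; rewrite -chiD //; congr chi; rewrite /dot3 /w /=;
      ring.
  rewrite sum_dot3 /w; congr (if _ then _ else _).
  case: (syndrome u) (syndrome t) => [[a b] c] [[a' b'] c'].
  by rewrite !xpair_eqE /= !addr_eq0 !oppr_pchar2.
apply: (@le_trans _ _ (\sum_(t | distinct3 t) 6 * q ^+ 3)).
  apply: ler_sum => t dt; rewrite sumr_const -[_ *+ #|_|]mulr_natl ler_wpM2r //.
  by rewrite (ler_nat _ _ 6) card_syndrome_fiber.
rewrite sumr_const -[_ *+ #|_|]mulr_natr ler_wpM2l //.
apply: (@le_trans _ _ (#|F|.-1 * #|F| ^ 2)%:R).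
  by rewrite ler_nat card_distinct3.
have F0 : (0 < #|F|)%N by apply/card_gt0P; exists 0.
by rewrite natrM natrX -subn1 natrB // natz.
Qed.

(** Scaling by k permutes the triples of distinct nonzero elements. *)
Lemma triple_sum_scale (k : F) : k != 0 ->
  triple_sum (k ^+ 3, k, k^-1) = triple_sum (1, 1, 1).
Proof.
move=> k0; rewrite [RHS](reindex_inj (h := fun t : F * F * F => (k * t.1.1,
  k * t.1.2, k * t.2))).
  apply: eq_big => [[[x y] z]|[[x y] z] _]; rewrite /distinct3 /dot3 /=.
    by rewrite !mulf_eq0 (negbTE k0) /= !(inj_eq (mulfI k0)).
  by congr chi; rewrite !invfM; ring.
by move=> [[x y] z] [[x' y'] z'] [] /(mulfI k0) -> /(mulfI k0) -> /(mulfI k0) ->.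
Qed.

Lemma sum_neq0_1 : \sum_(b : F | b != 0) (1 : int) = q - 1.
Proof.
have F1 : (0 < #|F|)%N by exact: ltnW (finNzRing_gt1 F).
rewrite sumr_const natz; have -> : #|[pred x : F | x != 0]| = #|F|.-1.
  by rewrite -(cardC1 (0 : F)); apply: eq_card => x; rewrite !inE.
by rewrite -subn1 -subzn.
Qed.

Lemma triple_sum1 : triple_sum (1, 1, 1) =
  mixed_sum ^+ 3 - (3 * q - 5) * mixed_sum.
Proof.
have := @sum_distinct_triples F (fun x => chi (x ^+ 3 + x + x^-1))
  (fun x => x != 0).
rewrite sum_neq0_1 -/mixed_sum => E;
  transitivity (mixed_sum ^+ 3 - (3 * (q - 1) - 2) * mixed_sum).
  rewrite -E => [|x _]; last exact: chi_sqr_eq1.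
  apply: eq_big => [[[x y] z]|[[x y] z] _] //=.
  by rewrite -!chiD // /dot3 /=; congr chi; ring.
ring.
Qed.

(** Only the q - 1 parameters (k^3, k, 1/k) are kept in Parseval's sum; they all contribute the same
    square. *)
Lemma triple_sum_bound : (mixed_sum ^+ 3 - (3 * q - 5) * mixed_sum)
  ^+ 2 <= 6 * q ^+ 5.
Proof.
rewrite -triple_sum1.
have F1 : (1 < #|F|)%N by exact: finNzRing_gt1.
have q2 : 0 < q - 1 by rewrite subr_gt0 ltz_nat.
rewrite -(ler_pM2l q2); apply: (@le_trans _ _ (6 * q ^+ 3 * ((q - 1) * q ^+ 2)));
  last first.
  by rewrite le_eqVlt; apply/orP; left; apply/eqP; ring.
apply: le_trans sum_triple_sum_sqr.
pose g (k : F) := (k ^+ 3, k, k^-1).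
have ginj : injective g by move=> k l [].
rewrite (bigID (fun a => a \in [set g k | k in [set~ 0]])) /= -[X in X <= _]addr0.
apply: lerD; last by apply: sumr_ge0 => a _; exact: sqr_ge0.
rewrite big_imset /=; last by move=> k l _ _; exact: ginj.
rewrite (eq_bigr (fun=> triple_sum (1, 1, 1) ^+ 2)).
  rewrite sumr_const cardsC1 -mulr_natl natz -subn1 -subzn //; exact: ltnW.
by move=> k; rewrite !inE => k0; rewrite triple_sum_scale.
Qed.

(** * The sum of the scores over b *)

Lemma quad_const_neq0 (v : F) : quad_param v -> quad_const v != 0.
Proof.
by case/and3P => v0 v1 n0; rewrite !mulf_neq0 ?expf_neq0 ?invr_eq0 ?expf_neq0.
Qed.

Lemma parity_quad_const (v : F) : quad_param v ->
  parity (quad_const v) = chi (v ^+ 3 + v + v^-1).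
Proof.
case/and3P => v0 v1 n0; have /chi1P/eqP := const_parity F2 v0 v1 n0.
rewrite 2!(chiD F2) -/(parity (quad_const v)) -mulrA -chiD // => e.
have -> : v ^+ 3 + v + v^-1 = v ^+ 3 + v + 1 + (1 + v^-1).
  by rewrite addrA -(addrA (v ^+ 3 + v)) addff addr0.
rewrite -[LHS]mulr1 -(chi_sqr_eq1 F2 (v ^+ 3 + v + 1 + (1 + v^-1))).
by rewrite mulrA e mul1r.
Qed.

(* The excluded v are 1 and the at most two zeros of v^2 + v + 1. *)
Lemma sum_quad_param (f : F -> int) : (forall v, `|f v| <= 1) ->
  \sum_(v : F | v != 0) f v - 3 <= \sum_(v : F | quad_param v) f v.
Proof.
move=> f1; rewrite (bigID (fun v => quad_param v)) /=.
rewrite [X in X + _ - _](eq_bigl (fun v => quad_param v)); last first.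
  by move=> v; rewrite /quad_param; case: (v != 0).
rewrite lerBlDl addrC lerD2r.
set A := [set v : F | (v != 0) && ~~ quad_param v].
have cA : (#|A| <= 3)%N.
  pose p : {poly F} := monic_cubic 0 0 1.
  have rA : all (root p) (enum A).
    apply/allP => v; rewrite mem_enum inE /quad_param => /andP[-> /=].
    rewrite negb_and !negbK /p rootE !hornerE => nv.
    have -> : v ^+ 3 + 1 = (v + 1) * quad_norm v by rewrite /quad_norm; char2_ring.
    by case/orP: nv => /eqP ->; rewrite ?mul0r ?mulr0.
  have := max_poly_roots (monic_neq0 (cubic_monic _ _ _)) rA (enum_uniq A).
  by rewrite size_cubic -cardE.
apply: (@le_trans _ _ (\sum_(v in A) 1)).
  rewrite [X in X <= _](eq_bigl (mem A)); last by move=> v; rewrite !inE.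
  by apply: ler_sum => v _; apply: le_trans (ler_norm _) (f1 v).
by rewrite sumr_const (ler_nat _ _ 3).
Qed.

Lemma chi_norm (x : F) : `|chi x| <= 1.
Proof. by case: (chi_pm1 x) => ->. Qed.

(** Under b -> 1/b the argument 1 + b runs over all elements except 1, and chi sums to 0 over F. *)
Lemma sum_parity : \sum_(b : F | b != 0) parity b = - chi (1 : F).
Proof.
rewrite (reindex_inj invr_inj) /=.
rewrite (eq_bigl (fun b : F => b != 0)) => [|b]; last by rewrite invr_eq0.
have := sum_chi F2; rewrite (reindex_inj (addrI (1 : F))) (bigD1 0) //= addr0.
move=> /eqP; rewrite addrC addr_eq0 => /eqP <-; apply: eq_bigr => b _.
by rewrite /parity invrK.
Qed.

(** After x -> 1/x the argument is 1 + x^3 + x + x / (x + 1)^2, whose last term has the form z^2 + z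
    with z = 1 / (x + 1). The 2 accounts for x = 0 and x = 1. *)
Lemma sum_parity_roots :
  \sum_(x : F | x ^+ 5 + x ^+ 3 != 0) parity (x ^+ 5 + x ^+ 3) =
  chi (1 : F) * (cubic_sum - 2).
Proof.
have E (x : F) : (x ^+ 5 + x ^+ 3 == 0) = (x == 0) || (x == 1).
  have -> : x ^+ 5 + x ^+ 3 = x ^+ 3 * (x + 1) ^+ 2 by char2_ring.
  by rewrite mulf_eq0 expf_eq0 sqrf_eq0 addr_eq0 oppr_pchar2.
rewrite (eq_bigl (fun x : F => ~~ ((x == 0) || (x == 1)))) => [|x];
  last by rewrite E.
rewrite (reindex_inj invr_inj) /=.
rewrite (eq_bigl (fun x : F => (x != 0) && (x != 1))) => [|x]; last first.
  by rewrite negb_or invr_eq0 invr_eq1.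
have -> : cubic_sum - 2 = \sum_(x : F | (x != 0) && (x != 1)) chi (x ^+ 3 + x).
  rewrite /cubic_sum (bigD1 0) //= (bigD1 1) ?oner_neq0 //=.
  by rewrite expr0n add0r expr1n addff !chi0 //; ring.
rewrite mulr_sumr; apply: eq_bigr => x /andP[x0 x1].
have w0 : x + 1 <> 0 by move/addff_eq => /eqP; rewrite (negbTE x1).
move/eqP: x0 => x0; rewrite /parity -chiD //.
have -> : 1 + (x^-1 ^+ 5 + x^-1 ^+ 3)^-1 =
  1 + (x ^+ 3 + x) + (((x + 1)^-1) ^+ 2 + (x + 1)^-1).
  have d0 : x ^+ 2 + 1 <> 0.
    have -> : x ^+ 2 + 1 = (x + 1) ^+ 2 by char2_ring.
    by apply/eqP; rewrite sqrf_eq0; apply/eqP.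
  have -> : (x^-1 ^+ 5 + x^-1 ^+ 3)^-1 = x ^+ 5 / (x ^+ 2 + 1) by char2_field.
  by char2_field.
by rewrite (chiD F2 _ (_ ^+ 2 + _)) chi_sqrD // mulr1.
Qed.

Lemma sum_roots (w : F -> int) :
  \sum_(b : F | b != 0) w b * #|roots b|%:Z =
  \sum_(x : F | x ^+ 5 + x ^+ 3 != 0) w (x ^+ 5 + x ^+ 3).
Proof. exact: (sum_card_fibers (fun x => x ^+ 5 + x ^+ 3) predT). Qed.

Lemma sum_quads (w : F -> int) :
  \sum_(b : F | b != 0) w b * #|quads b|%:Z =
  \sum_(v : F | quad_param v) w (quad_const v).
Proof.
rewrite (sum_card_fibers (@quad_const F) (@quad_param F)); apply: eq_bigl => v.
by case: (boolP (quad_param v)) => // /quad_const_neq0.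
Qed.

(** Sums over b of numbers of roots or factors become sums over x or v. The main terms give (3 - 7 +
    5) q = q, and 53 more than covers the excluded x and v and the terms in chi(1). *)
Lemma sum_score : q - 53 + 5 * mixed_sum - `|cubic_sum| <=
  \sum_(b : F | b != 0) score b.
Proof.
have -> : \sum_(b : F | b != 0) score b =
    3 * (q - 1) - 7 * (\sum_(x : F | x ^+ 5 + x ^+ 3 != 0) 1)
    + 5 * (\sum_(v : F | quad_param v) 1)
    + 6 * (\sum_(v : F | quad_param v) chi (1 + v^-1))
    + (5 * (\sum_(v : F | quad_param v) parity (quad_const v))
       - \sum_(x : F | x ^+ 5 + x ^+ 3 != 0) parity (x ^+ 5 + x ^+ 3)
       - 3 * \sum_(b : F | b != 0) parity b).
  rewrite -(sum_roots (fun=> 1)) -(sum_quads (fun=> 1)) -sum_roots -sum_quads.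
  have -> : \sum_(v : F | quad_param v) chi (1 + v^-1) =
      \sum_(b : F | b != 0) \sum_(v in quads b) chi (1 + v^-1).
    rewrite (sum_fibers (@quad_const F) (@quad_param F) (fun _ v => chi (1 +
      v^-1))).
    by apply: eq_bigl => v; case: (boolP (quad_param v)) => // /quad_const_neq0.
  rewrite -sum_neq0_1 !mulr_sumr -!(sumrB, big_split) /=.
  by apply: eq_bigr => b _; rewrite /score; ring.
have -> : \sum_(x : F | x ^+ 5 + x ^+ 3 != 0) (1 : int) = q - 2.
  rewrite (eq_bigl (fun x : F => (x != 0) && (x != 1))) => [|x].
    have := sum_neq0_1; rewrite (bigD1 1) ?oner_neq0 //= => e.
    by apply: (addrI (1 : int)); rewrite e; ring.
  have -> : x ^+ 5 + x ^+ 3 = x ^+ 3 * (x + 1) ^+ 2 by char2_ring.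
  by rewrite mulf_eq0 expf_eq0 sqrf_eq0 addr_eq0 oppr_pchar2 // negb_or.
rewrite (eq_bigr _ parity_quad_const) sum_parity_roots sum_parity.
have b1 := @sum_quad_param (fun=> 1) (fun=> lexx _); rewrite sum_neq0_1 in b1.
have b2 := @sum_quad_param (fun v => chi (1 + v^-1)) (fun v => chi_norm _).
have b3 := @sum_quad_param (fun v => chi (v ^+ 3 + v + v^-1)) (fun v => chi_norm _).
have e2 := sum_parity; rewrite /parity in e2.
rewrite e2 in b2; rewrite -/mixed_sum in b3.
have n1 := ler_norm cubic_sum.
have n2 := ler_norm (- cubic_sum); rewrite normrN in n2.
move: b1 b2 b3.
set x1 := \sum_(v | _) 1; set x2 := \sum_(v | _) _; set x3 := \sum_(v | _) _.
by case: (chi_pm1 (1 : F)) => ->; lia.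
Qed.

(** If no quintic split, all scores would be at most 0, and so would their sum. *)
Lemma exists_split_quintic : (2 ^ 17 <= #|F|)%N ->
  exists2 b : F, b != 0 & #|roots b| = 5%N.
Proof.
move=> Fge; case: (boolP [exists b : F, (b != 0) && (#|roots b| == 5%N)]).
  by case/existsP => b /andP[b0 /eqP r5]; exists b.
rewrite negb_exists => /forallP no; exfalso.
have le0 : \sum_(b : F | b != 0) score b <= 0.
  apply: sumr_le0 => b b0; apply: score_le0 => // r5.
  by have := no b; rewrite b0 r5 eqxx.
apply: (@numeric_contradiction _ q (- mixed_sum) `|cubic_sum|).
- by rewrite -[leRHS]natz -(natrX int) ler_nat.
- exact: normr_ge0.
- by rewrite -normrX ger0_norm ?sqr_ge0 // cubic_sum_sqr.
- apply: le_trans le0; apply: le_trans sum_score; rewrite mulrN opprK; lia.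
- apply: le_trans triple_sum_bound.
  by rewrite -[leRHS]sqrrN le_eqVlt; apply/orP; left; apply/eqP; ring.
Qed.
End Estimates.

(** * Words of weight at most five *)

Section Weights.
Variable F : finFieldType.
Hypothesis F2 : 2 \in [pchar F].
Add Field F_field : (field_theory_of F) (morphism (bool_morph F2),
  constants [bool_cst], power_tac (power_theory_of F) [nat_cst]).
Let addff (x : F) : x + x = 0. Proof. exact: addrr_pchar2. Qed.
Let addff_eq (x y : F) : x + y = 0 -> x = y. Proof. exact: char2_addr_eq0. Qed.

Lemma cube_sum_collision (x y z w : F) : x + y + z = w ->
  x ^+ 3 + y ^+ 3 + z ^+ 3 = w ^+ 3 -> [|| x == y, x == z | y == z].
Proof.
move=> <- e; have : (x + y) * (x + z) * (y + z) = 0.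
  transitivity (x ^+ 3 + y ^+ 3 + z ^+ 3 + (x + y + z) ^+ 3); first by char2_ring.
  by rewrite e addff.
by move/eqP; rewrite !mulf_eq0 !addr_eq0 !oppr_pchar2 // -orbA.
Qed.

Lemma zero_sums_card (A : {set F}) : A != set0 -> 0 \notin A ->
  \sum_(x in A) x = 0 -> \sum_(x in A) x ^+ 3 = 0 -> (5 <= #|A|)%N.
Proof.
move=> A0 n0; rewrite -big_enum /= -[\sum_(x in A) x ^+ 3]big_enum /= cardE.
have : 0 \notin enum A by rewrite mem_enum.
have : enum A != [::] by apply: contraNneq A0 => e; rewrite -cards_eq0 cardE e.
have := enum_uniq A; case: (enum A) => [|x [|y [|z [|w [|? ?]]]]] //=;
  rewrite !big_cons !big_nil !inE !addr0 ?negb_or.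
- by move=> _ _ nx x0; rewrite x0 eqxx in nx.
- by move=> /andP[/negP xy _] _ _ /addff_eq e; case: xy; rewrite e.
- move=> /and3P[/andP[xy xz] yz _] _ _; rewrite !addrA => e e3.
  (* Three elements are treated as four with w = 0. *)
  have := @cube_sum_collision x y z 0 e; rewrite expr0n e3 => /(_ erefl).
  by rewrite (negbTE xy) (negbTE xz) (negbTE yz).
- move=> /and4P[/and3P[xy xz _] /andP[yz _] _ _] _ _; rewrite !addrA => e e3.
  have := @cube_sum_collision x y z w (addff_eq e) (addff_eq e3).
  by rewrite (negbTE xy) (negbTE xz) (negbTE yz).
Qed.

(** The coefficients of X^4 and X^2 give e_1 = e_3 = 0, hence p_3 = e_1^3 + e_1 e_2 + e_3 = 0. For
    the inverses, b / x = x^4 + a x^2 and squaring is additive. *)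
Lemma split_quintic_sums (a b : F) (A : {set F}) : b != 0 -> #|A| = 5%N ->
  (forall x, x \in A -> x ^+ 5 + a * x ^+ 3 = b) ->
  [/\ 0 \notin A, \sum_(x in A) x = 0, \sum_(x in A) x ^+ 3 = 0 &
      \sum_(x in A) x^-1 = 0].
Proof.
move=> b0 A5 hA.
pose p : {poly F} := 'X^5 + a%:P * 'X^3 + b%:P.
have [pm sp] : p \is monic /\ size p = 6%N.
  by apply: monic_coefP => [|[|[|[|[|[|[|i]]]]]]] //;
    rewrite !coefE /= !(mulr0, addr0).
have n0 : 0 \notin A.
  by apply/negP => /hA; rewrite !expr0n mulr0 addr0 => /esym/eqP;
    rewrite (negbTE b0).
have rA : all (root p) (enum A).
  apply/allP => x; rewrite mem_enum => /hA e.
  by rewrite rootE /p !hornerD hornerXn hornerC hornerCM hornerXn e addff.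
have := all_roots_prod_XsubC _ rA; rewrite sp -cardE A5 uniq_rootsE enum_uniq.
move=> /(_ erefl erefl); rewrite (monicP pm) scale1r.
move=> pE; have [e1 e3] : \sum_(x in A) x = 0 /\ \sum_(x in A) x ^+ 3 = 0.
  rewrite -big_enum -[\sum_(x in A) x ^+ 3]big_enum /=.
  have := A5; rewrite cardE;
    case: (enum A) pE => [|x [|y [|z [|t [|w [|]]]]]] //= pE _.
  rewrite !big_cons !big_nil !addr0.
  have {pE} pE : p = 'X^5 - (x + y + z + t + w)%:P * 'X^4 +
      (x * y + x * z + x * t + x * w + y * z + y * t + y * w + z * t + z * w +
        t * w)%:P * 'X^3
      - (x * y * z + x * y * t + x * y * w + x * z * t + x * z * w + x * t * w +
        y * z * t +
       y * z * w + y * t * w + z * t * w)%:P * 'X^2 +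
      (x * y * z * t + x * y * z * w + x * y * t * w + x * z * t * w +
        y * z * t * w)%:P * 'X
      - (x * y * z * t * w)%:P.
    by rewrite pE !big_cons big_nil; ring.
  have c i := congr1 (fun f : {poly F} => f`_i) pE.
  move: (c 4%N) (c 2%N);
    rewrite /p !coefE /= !(mulr0, mulr1, addr0, add0r, subr0, oppr0, sub0r).
  move=> /esym/eqP; rewrite oppr_eq0 => /eqP e1 /esym/eqP;
    rewrite oppr_eq0 => /eqP e3.
  split; first by rewrite -e1; ring.
  transitivity ((x + y + z + t + w) ^+ 3 + (x + y + z + t + w) *
    (x * y + x * z + x * t + x * w + y * z + y * t + y * w + z * t + z * w +
      t * w) +
    (x * y * z + x * y * t + x * y * w + x * z * t + x * z * w + x * t * w +
      y * z * t +
       y * z * w + y * t * w + z * t * w)); first by char2_ring.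
  by rewrite e1 e3 expr0n mul0r !addr0.
split=> //.
apply: (mulfI b0); rewrite mulr0 mulr_sumr.
rewrite (eq_bigr (fun x => (x ^+ 2) ^+ 2 + a * x ^+ 2)) => [|x xA]; last first.
  have x0 : x <> 0 by apply/eqP; apply: contraNneq n0 => <-.
  by rewrite -(hA x xA); char2_field.
rewrite big_split /= -mulr_sumr.
have sq (f : F -> F) : \sum_(x in A) f x ^+ 2 = (\sum_(x in A) f x) ^+ 2.
  by rewrite -[RHS]/(pFrobenius_aut F2 _) rmorph_sum.
by rewrite !sq e1 !expr0n mulr0 addr0.
Qed.

Lemma exists_zero_sums (m : nat) (z : F) : (16 <= m)%N -> #|F| = (2 ^ m)%N ->
  (2 ^ m - 1).-primitive_root z -> exists A : {set F},
  #|A| = 5%N /\ [/\ 0 \notin A, \sum_(x in A) x = 0,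
    \sum_(x in A) x ^+ 3 = 0 & \sum_(x in A) x^-1 = 0].
Proof.
rewrite leq_eqVlt => /orP[/eqP m16|m17] cF pz.
  (* Since 2^4 = 1 modulo 5, there is a primitive fifth root of unity w; its powers are the roots of
     X^5 + 1. *)
  have d5 : (5 %| 2 ^ m - 1)%N.
    have -> : m = (4 * 4)%N by rewrite -m16.
    by rewrite -eqn_mod_dvd ?expn_gt0 // expnM -modnXm exp1n.
  have pw := dvdn_prim_root pz d5; set w := z ^+ _ in pw.
  exists [set w ^+ (i : 'I_5) | i : 'I_5].
  have c5 : #|[set w ^+ (i : 'I_5) | i : 'I_5]| = 5%N.
    rewrite card_imset ?card_ord // => i j /eqP.
    by rewrite (eq_prim_root_expr pw) !modn_small // => /eqP/val_inj.
  split=> //; apply: (@split_quintic_sums 0 1) => //; first exact: oner_neq0.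
  move=> _ /imsetP[i _ ->]; rewrite mul0r addr0 exprAC (prim_expr_order pw).
  by rewrite expr1n.
have [|b b0 r5] := exists_split_quintic F2; first by rewrite cF leq_exp2l.
exists (roots b); split=> //; apply: (@split_quintic_sums 1 b) => // x.
by rewrite inE mul1r => /eqP.
Qed.
End Weights.

(** * The code *)

Section MinimalPolynomials.
Variable L : fieldExtType 'F_2.
Implicit Types (x y : L) (c : {poly 'F_2}).

Definition eval c x : L := (map_poly (in_alg L) c).[x].

Lemma base_minPoly_dvd c x : (base_minPoly x %| c) = (eval c x == 0).
Proof.
rewrite -(dvdp_map (in_alg L)) base_minPolyE; apply/idP/eqP => [|/eqP c0].
  by move/dvdpP => [p E]; rewrite /eval E hornerM (rootP (root_minPoly 1 x)) mulr0.
by apply: minPoly_dvdp => //; apply/polyOver1P; exists c.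
Qed.

Lemma base_minPoly_irreducible x : irreducible_poly (base_minPoly x).
Proof.
split.
  by rewrite -(size_map_poly (in_alg L)) base_minPolyE size_minPoly.
move=> p p1 dp; have := @minPoly_irr _ _ 1%AS x (map_poly (in_alg L) p).
rewrite -base_minPolyE dvdp_map eqp_map => /(_ _ dp)/orP[|//|].
  by apply/polyOver1P; exists p.
by rewrite -(rmorph1 (map_poly (in_alg L))) eqp_map => /eqp_size;
  rewrite size_poly1 => e; rewrite e in p1.
Qed.

(** Irreducible polynomials that are not coprime agree up to a unit, so x would be a Galois
    conjugate of y; the Galois group is generated by squaring. *)
Lemma coprime_base_minPoly x y : (forall i, x != y ^+ (2 ^ i)) ->
  coprimep (base_minPoly y) (base_minPoly x).
Proof.
move=> xy; rewrite (irreducible_poly_coprime _ (base_minPoly_irreducible y)).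
apply/negP => d; have : base_minPoly y %= base_minPoly x.
  by apply: (base_minPoly_irreducible x).2 => //;
    have [] := base_minPoly_irreducible y; case: size => [|[]].
rewrite -(eqp_map (in_alg L)) !base_minPolyE => e.
have rx : root (minPoly 1 y) x by rewrite (eqp_root e) root_minPoly.
have s1 : (1 <= {:finvect_type L})%VS by exact: sub1v.
have /and3P[_ _ nE] := @finField_galois _ (finvect_type L)
  1%AS {:finvect_type L}%AS s1.
have [g gG gx] := normalField_root_minPoly s1 nE (memvf (y : finvect_type L)) rx.
have [s sG sE] := finField_galois_generator s1.
move: gG; rewrite (eqP sG) => /fingroup.cycleP[i gi].
have sX j : (s ^+ j)%g y = y ^+ (2 ^ j).
  elim: j => [|j IH]; first by rewrite fingroup.expg0 gal_id expr1.
  rewrite fingroup.expgSr galM ?memvf // IH rmorphXn /= sE ?memvf //.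
  by rewrite card_Fp // dimv1 expn1 -exprM -expnS.
by have := xy i; rewrite -gx gi sX eqxx.
Qed.
End MinimalPolynomials.

(** * Codewords as polynomials vanishing at given elements *)

Section CyclicCodes.
Variables (L : fieldExtType 'F_2) (n : nat).
Hypothesis n_gt0 : (0 < n)%N.
Implicit Types (g : {poly 'F_2}) (u v : 'rV['F_2]_n) (x : L).

Definition word_poly u : {poly 'F_2} := \sum_(i < n) u 0 i *: 'X^i.

(** Here n > 0 keeps the modulus from being replaced by its default value. *)
Lemma mk_monic_Xn_sub1 : mk_monic ('X^n - 1 : {poly 'F_2}) = 'X^n - 1.
Proof.
by rewrite /mk_monic -polyC1 size_XnsubC // ltnS n_gt0 monicXnsubC.
Qed.

Lemma eval_word u x : eval (word_poly u) x = \sum_(i < n) (u 0 i)%:A * x ^+ i.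
Proof.
rewrite /eval /word_poly rmorph_sum horner_sum; apply: eq_bigr => i _.
by rewrite /= map_polyZ map_polyXn hornerZ hornerXn.
Qed.

Lemma word_poly_row (c : {poly 'F_2}) : (size c <= n)%N ->
  word_poly (\row_i c`_i) = c.
Proof.
move=> sc; rewrite /word_poly; under eq_bigr do rewrite mxE.
rewrite -(poly_def n (fun i => c`_i)); apply/polyP => i; rewrite coef_poly.
by case: ltnP => // ni; rewrite nth_default // (leq_trans sc).
Qed.

(** Reduction modulo X^n - 1 does not change the value at an n-th root of unity. *)
Lemma cyclic_code_eval g u x : x ^+ n = 1 -> eval g x = 0 ->
  u \in cyclic_code n g -> eval (word_poly u) x = 0.
Proof.
move=> xn gx /imsetP[c /imsetP[a _ ->] ->].
set h : {poly 'F_2} := 'X^n - 1.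
have hx : eval h x = 0.
  by rewrite /eval /h rmorphB rmorph1 /= map_polyXn !hornerE xn subrr.
have ev (p : {poly 'F_2}) : eval (Pdiv.Ring.rmodp p (mk_monic h)) x = eval p x.
  rewrite [in RHS](Pdiv.RingMonic.rdivp_eq (monic_mk_monic h) p).
  rewrite mk_monic_Xn_sub1 -/h /eval rmorphD rmorphM hornerD hornerM.
  by rewrite -!/(eval _ _) hx mulr0 add0r.
rewrite word_poly_row.
  rewrite poly_of_qpolyM ev /eval rmorphM hornerM -!/(eval _ _).
  by rewrite [X in _ * X]ev gx mulr0.
rewrite -ltnS; apply: leq_trans (size_mk_monic _) _.
by rewrite mk_monic_Xn_sub1 -polyC1 size_XnsubC.
Qed.

Lemma dvdp_cyclic_code g u : g %| word_poly u -> u \in cyclic_code n g.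
Proof.
move=> /dvdpP[p pE]; apply/imsetP.
exists (in_qpoly ('X^n - 1) (word_poly u)).
  by apply/imsetP; exists (in_qpoly ('X^n - 1) p); rewrite // -in_qpolyM pE.
apply/rowP => i; rewrite mxE in_qpoly_small.
  rewrite /word_poly coef_sum (bigD1 i) //= coefZ coefXn eqxx mulr1 big1 ?addr0 //.
  move=> j ji; rewrite coefZ coefXn.
  by have -> : (i == j :> nat) = false; [rewrite eq_sym;
    exact: negbTE | rewrite mulr0].
rewrite mk_monic_Xn_sub1 -polyC1 size_XnsubC // ltnS /word_poly.
apply: (leq_trans (size_sum _ _ _)); apply/bigmax_leqP => j _.
by rewrite (leq_trans (size_scale_leq _ _)) // size_polyXn.
Qed.

Lemma eval_word_sub u v x : eval (word_poly u) x - eval (word_poly v) x =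
  \sum_(i in [set i | u 0 i != v 0 i]) x ^+ i.
Proof.
rewrite !eval_word -sumrB [RHS]big_mkcond; apply: eq_bigr => i _.
rewrite inE -mulrBl -scalerBl.
have : u 0 i - v 0 i = (u 0 i != v 0 i)%:R.
  by case: (u 0 i) (v 0 i) => [[|[|[]]] ?] // [[|[|[]]] ?] //; apply/val_inj.
by move=> ->; case: (_ != _); rewrite ?scale1r ?scale0r ?mul1r ?mul0r.
Qed.
End CyclicCodes.

(** * The order of the generator and conjugacy of its powers *)

Section Generator.
Variables (L : fieldExtType 'F_2) (m : nat) (alpha : L).
Hypothesis m_ge : (4 <= m)%N.
Hypothesis cardL : #|finvect_type L| = (2 ^ m)%N.

(** If alpha has order k, all 2^m - 1 nonzero elements are k-th roots of unity, so k is at least 2^m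
    - 1. *)
Lemma mul_generator_prim_root : mul_generator alpha ->
  (2 ^ m - 1).-primitive_root alpha.
Proof.
case=> a0 gen.
have n_gt0 : (0 < 2 ^ m - 1)%N.
  by rewrite subn_gt0 -(expn0 2) ltn_exp2l // (leq_trans _ m_ge).
have xn (x : L) : x != 0 -> x ^+ (2 ^ m - 1) = 1.
  move=> x0; apply: (mulfI x0); rewrite -exprS mulr1 subn1 prednK ?expn_gt0 //.
  by rewrite -cardL; exact: (@expf_card (finvect_type L)).
have [k pk kn] := prim_order_exists n_gt0 (xn _ a0).
suff nk : (2 ^ m - 1 <= k)%N.
  by have -> : (2 ^ m - 1)%N = k by apply/eqP; rewrite eqn_leq nk dvdn_leq.
have k0 := prim_order_gt0 pk.
pose rs : seq (finvect_type L) := enum [set~ 0].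
have -> : (2 ^ m - 1)%N = size rs by rewrite /rs -cardE cardsC1 cardL subn1.
apply: (@max_unity_roots (finvect_type L)) => //; last exact: enum_uniq.
apply/allP => x; rewrite mem_enum !inE => x0; rewrite unity_rootE.
have [i ->] := gen x x0.
by rewrite exprnP exprzAC -exprnP (prim_expr_order pk) exp1rz.
Qed.
End Generator.

Section Exponents.
Variables (L : fieldExtType 'F_2) (m : nat) (alpha : L).
Hypothesis m_ge : (4 <= m)%N.
Hypothesis cardL : #|finvect_type L| = (2 ^ m)%N.
Hypothesis prim : (2 ^ m - 1).-primitive_root alpha.

Lemma frob_mod (x : L) i : x ^+ (2 ^ i) = x ^+ (2 ^ (i %% m)).
Proof.
have xm (y : L) : y ^+ (2 ^ m) = y.
  by rewrite -cardL; exact: (@expf_card (finvect_type L)).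
rewrite {1}(divn_eq i m) expnD exprM; congr (_ ^+ _).
by elim: (i %/ m)%N => [|k IH]; rewrite ?expr1 // mulSn expnD exprM xm.
Qed.

Let pow_lt r : (r < m)%N -> (2 ^ r <= 2 ^ m.-1)%N.
Proof. by move=> rm; rewrite leq_exp2l // -ltnS prednK // (leq_trans _ rm). Qed.
Let m_gt0 : (0 < m)%N. Proof. exact: leq_trans m_ge. Qed.
Let pow_m : (2 ^ m = 2 * 2 ^ m.-1)%N. Proof. by rewrite -expnS prednK. Qed.
Let pow_m1 : (8 <= 2 ^ m.-1)%N.
Proof. by rewrite -[8%N]/(2 ^ 3)%N leq_exp2l // -ltnS prednK. Qed.
Let even_m1 : exists k, (2 ^ m.-1 = 2 * k)%N.
Proof. by case: (m) m_ge => [|[|k]] // _; exists (2 ^ k)%N; rewrite expnS. Qed.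

(** Once i is reduced modulo m, both exponents lie below the order 2^m - 1, and 3 is not a power of
    2. *)
Lemma cube_not_conjugate i : alpha ^+ 3 != alpha ^+ (2 ^ i).
Proof.
rewrite frob_mod (eq_prim_root_expr prim).
have := ltn_pmod i m_gt0; move: (i %% m)%N => r rm; have := pow_lt rm.
move=> rle; rewrite !modn_small; last 2 first.
- by rewrite pow_m; lia.
- by rewrite pow_m; lia.
by case: r {rm rle} => [|[|r]] //; rewrite !expnS; lia.
Qed.

(** Equality would make 2^m - 1 divide the smaller positive number 2^r + 1, r < m. *)
Lemma inverse_not_conjugate i : alpha^-1 != alpha ^+ (2 ^ i).
Proof.
rewrite frob_mod; have := ltn_pmod i m_gt0; move: (i %% m)%N => r rm.
apply/eqP => e; have : alpha ^+ (2 ^ r).+1 = 1.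
  by rewrite exprSr -e mulVf // (prim_root_eq0 prim); rewrite pow_m; lia.
move/eqP; rewrite -(prim_order_dvd prim) => /dvdn_leq => /(_ isT).
by have := pow_lt rm; rewrite pow_m; lia.
Qed.

(** The order 2^m - 1 would divide 3 2^r + 1, which is less than twice the order, so 2^m = 3 2^r +
    2. The right side is 5 for r = 0, 8 for r = 1, and 2 modulo 4 for r >= 2, against m >= 4. *)
Lemma inverse_not_conjugate_cube i : alpha^-1 != (alpha ^+ 3) ^+ (2 ^ i).
Proof.
rewrite frob_mod; have := ltn_pmod i m_gt0; move: (i %% m)%N => r rm.
apply/eqP => e; have : alpha ^+ (3 * 2 ^ r).+1 = 1.
  by rewrite exprSr exprM -e mulVf // (prim_root_eq0 prim); rewrite pow_m; lia.
move/eqP; rewrite -(prim_order_dvd prim) => /dvdnP[k kE].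
have rle := pow_lt rm; rewrite pow_m in kE.
have [j jE] := even_m1.
have k1 : k = 1%N.
  case: k kE => [|[|k]] // kE.
  have : (2 * (2 * 2 ^ m.-1 - 1) <= k.+2 * (2 * 2 ^ m.-1 - 1))%N.
    by rewrite leq_mul2r orbT.
  by rewrite -kE; lia.
move: kE; rewrite k1 mul1n; case: r {rm e} rle => [|[|r]] _;
  rewrite ?expn0 ?expn1; try lia.
rewrite !expnS; lia.
Qed.
End Exponents.

(** * The minimum distance of the code *)

Theorem theorem4 (m : nat) (L : fieldExtType 'F_2) (alpha : L) :
  (16 <= m)%N ->
  #|finvect_type L| = (2 ^ m)%N ->
  mul_generator alpha ->
  has_minimum_distance
    (cyclic_code (2 ^ m - 1)%N
       (base_minPoly (alpha ^ 1) * base_minPoly (alpha ^ (-1))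
          * base_minPoly (alpha ^ 3)))
    5.
Proof.
move=> m16 cardL gen.
have m4 : (4 <= m)%N by apply: leq_trans m16.
have prim := mul_generator_prim_root m4 cardL gen.
set n := (2 ^ m - 1)%N in prim *.
have n_gt0 := prim_order_gt0 prim.
have a0 : alpha != 0 by case: gen.
have L2 : 2 \in [pchar (finvect_type L)] by rewrite (pchar_lalg L) pchar_Fp.
rewrite expr1z -invr_expz expr1z -[3]/(Posz 3) -exprnP.
set g := (_ * _).
pose pw (i : 'I_n) : finvect_type L := alpha ^+ i.
have inj : injective pw.
  move=> i j /eqP; rewrite (eq_prim_root_expr prim) !modn_small //.
  by move=> /eqP/val_inj.
have gE (x : L) : (x = alpha \/ x = alpha^-1 \/ x = alpha ^+ 3) -> eval g x = 0.
  have mr (y : L) : eval (base_minPoly y) y = 0.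
    by apply/eqP; rewrite -base_minPoly_dvd dvdpp.
  rewrite /g /eval !rmorphM !hornerM -!/(eval _ _).
  by case=> [->|[->|->]]; rewrite mr ?mulr0 ?mul0r.
(* Lower bound: the powers of alpha at the positions where two codewords differ have vanishing sum
   and vanishing sum of cubes. *)
split; last first.
  move=> u v uC vC uv; set D := [set i | u 0 i != v 0 i].
  have sumD (x : L) : x ^+ n = 1 -> eval g x = 0 -> \sum_(i in D) x ^+ i = 0.
    move=> xn gx; rewrite -eval_word_sub.
    by rewrite !(@cyclic_code_eval _ _ n_gt0 g _ x xn gx) ?subrr.
  rewrite /hamming_distance -/D -(card_imset _ inj).
  have sumE k : \sum_(x in pw @: D) x ^+ k =
      \sum_(i in D) (alpha ^+ k) ^+ i.
    rewrite big_imset /=; last by move=> i j _ _; exact: inj.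
    by apply: eq_bigr => i _; rewrite exprAC.
  apply: (zero_sums_card L2).
  - rewrite -cards_eq0 card_imset // cards_eq0; apply: contraNneq uv => D0.
    apply/eqP/rowP => i; apply/eqP; have := in_set0 i; rewrite -D0 inE.
    by move/negbFE.
  - by apply/imsetP => -[i _ /esym/eqP]; rewrite expf_eq0 (negbTE a0) andbF.
  - transitivity (\sum_(x in pw @: D) x ^+ 1); first exact: eq_bigr.
    by rewrite sumE expr1 sumD ?(prim_expr_order prim) //; apply: gE; left.
  - rewrite sumE sumD //; last by apply: gE; right; right.
    by rewrite exprAC (prim_expr_order prim) expr1n.
have [A [A5 [A0 s1 s3 sV]]] := exists_zero_sums L2 m16 cardL prim.
(* The logarithms of the five elements are the support of a codeword at distance 5 from the zero
   word. *)
pose D := [set i | pw i \in A].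
pose u : 'rV['F_2]_n := \row_(i < n) (i \in D)%:R.
have AE : A = pw @: D.
  apply/setP => x; apply/idP/imsetP => [xA|[i + ->]]; last by rewrite inE.
  have x0 : x != 0 by apply: contraTneq xA => ->.
  have xn : (x : L) ^+ n = 1.
    apply: (mulfI x0); rewrite -exprS mulr1 /n subn1 prednK ?expn_gt0 // -cardL.
    exact: (@expf_card (finvect_type L)).
  by have [i xE] := prim_rootP prim xn; exists i; rewrite // inE /pw -xE.
have sumD (x : L) : eval (word_poly u) x = \sum_(i in D) x ^+ i.
  rewrite eval_word [RHS]big_mkcond; apply: eq_bigr => i _; rewrite mxE.
  by case: (_ \in _); rewrite ?scale1r ?scale0r ?mul1r ?mul0r.
have sumA (f : finvect_type L -> finvect_type L) :
    \sum_(x in A) f x = \sum_(i in D) f (pw i).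
  by rewrite AE big_imset //= => i j _ _; exact: inj.
exists u, 0; split.
- apply: dvdp_cyclic_code => //.
  have [r1 r2 r3] : [/\ eval (word_poly u) alpha = 0,
      eval (word_poly u) alpha^-1 = 0 & eval (word_poly u) (alpha ^+ 3) = 0].
    rewrite !sumD; split; first by rewrite -[RHS]s1 sumA.
      by rewrite -[RHS]sV sumA; apply: eq_bigr => i _; rewrite exprVn.
    by rewrite -[RHS]s3 sumA; apply: eq_bigr => i _; rewrite exprAC.
  (* The three minimal polynomials are pairwise coprime, so vanishing at the three elements gives
     divisibility by their product. *)
  rewrite /g Gauss_dvdp; last first.
    rewrite coprimepMl (coprime_base_minPoly (cube_not_conjugate m4 cardL prim)).
    rewrite coprimep_sym.
    exact: coprime_base_minPoly (inverse_not_conjugate_cube m4 cardL prim).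
  rewrite Gauss_dvdp; last first.
    exact: coprime_base_minPoly (inverse_not_conjugate m4 cardL prim).
  by rewrite !base_minPoly_dvd r1 r2 r3 eqxx.
- apply: dvdp_cyclic_code => //.
  by rewrite /word_poly big1 ?dvdp0 // => i _; rewrite mxE scale0r.
- apply/eqP => u0; suff : D = set0.
    by move=> D0; move: A5; rewrite AE D0 imset0 cards0.
  apply/setP => i; rewrite [RHS]inE; apply/negP => iD.
  have := congr1 (fun w : 'rV['F_2]_n => w 0 i) u0.
  by rewrite !mxE iD => /eqP; rewrite oner_eq0.
- rewrite /hamming_distance -[RHS]A5 AE card_imset //; apply: eq_card => i.
  rewrite [LHS]inE !mxE; by case: (_ \in _); rewrite ?oner_eq0 ?eqxx.
Qed.
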